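(* Let $n\ge 3$, let $TYM_n \colon B_n \to GL_n(\mathbb{Z}[t^{\pm1}])$ be the Tong-Yang-Ma representation of the braid group $B_n$, and let $\alpha \colon B_n \to \mathbb{Z}\cong\langle z\rangle$ be the abelianization, $\alpha(\sigma_i)=z$ for all $i$. Then the twisted Alexander invariant $\Delta_{B_n,TYM_n}(z)$ of $B_n$ associated with $TYM_n$ (and $\alpha$) is given, up to a factor $\varepsilon z^c$ with $\varepsilon\in(\mathbb{Z}[t^{\pm1}])^\times$ and $c\in\mathbb{Z}$, by $$\Delta_{B_n,TYM_n}(z)=\begin{cases}1+tz^3 & (n=3)\\ 1 & (n\ge 4).\end{cases}$$
   Context: Braid group: $B_n$ is the group with generators $\sigma_1,\dots,\sigma_{n-1}$ and relations $\sigma_i\sigma_j=\sigma_j\sigma_i$ for $|i-j|\ge 2$ and $\sigma_i\sigma_{i+1}\sigma_i=\sigma_{i+1}\sigma_i\sigma_{i+1}$ for $1\le i\le n-2$. Tong-Yang-Ma representation: $TYM_n\colon B_n\to GL_n(\mathbb{Z}[t^{\pm1}])$ is the homomorphism $\sigma_i\mapsto I_{i-1}\oplus\begin{pmatrix}0&1\\ t&0\end{pmatrix}\oplus I_{n-i-1}$, where $I_k$ is the $k\times k$ identity matrix. Twisted Alexander invariant (Wada): Let $G=\langle x_1,\dots,x_l\mid r_1,\dots,r_m\rangle$ be a finitely presented group, $\alpha\colon G\to\mathbb{Z}\cong\langle z\rangle$ a surjective homomorphism, $R$ a unique factorization domain, and $\rho\colon G\to GL_N(R)$ a representation. Let $F_l$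 be the free group on $x_1,\dots,x_l$, and let $\Phi\colon\mathbb{Z}[F_l]\to M_N(R[z^{\pm1}])$ be the ring homomorphism obtained by composing the linear extension of the projection $F_l\to G$ with the linear extension of $g\mapsto\rho(g)\alpha(g)$. For each $j$, the Fox derivation $\frac{\partial}{\partial x_j}\colon\mathbb{Z}[F_l]\to\mathbb{Z}[F_l]$ is the $\mathbb{Z}$-linear map with $\frac{\partial x_i}{\partial x_j}=\delta_{ij}$ and $\frac{\partial(gg')}{\partial x_j}=\frac{\partial g}{\partial x_j}+g\frac{\partial g'}{\partial x_j}$ for $g,g'\in F_l$. Let $M$ be the $m\times l$ block matrix whose $(i,j)$ block is the $N\times N$ matrix $\Phi\left(\frac{\partial r_i}{\partial x_j}\right)$. Let $M_j$ be the matrix obtained from $M$ by removing the $j$-th block column, regarded as an $mN\times(l-1)N$ matrix over $R[z^{\pm1}]$. For $I=(i_1<\dots<i_{(l-1)N})$ with $1\le i_k\le mN$, let $M_j^I$ be the square submatrix of $M_j$ consisting of the rows $i_1,\dots,i_{(l-1)N}$. There is always some $j$ with $\det\Phi(1-x_j)\neq0$, and for such $j$ one defines $$\Delta_{G,\rho}(z):=\frac{\gcd_I(\det M_j^I)}{\det\Phi(1-x_j)},$$ the gcd being taken in $R[z^{\pm1}]$ over all choices of $I$ (if $m<l-1$, one sets $\Delta_{G,\rho}(z):=0$). It is well defined up to a factor $\varepsilon z^c$ ($\varepsilon\in R^\times$, $c\in\mathbb{Z}$), independently of the choice of $j$ and of the presentation of $G$; equalities of twisted Alexander invariants are understood up to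 such factors. *)

(* Defs.v *)
From HB Require Import structures.
From mathcomp Require Import all_boot all_order all_algebra.
From mathcomp Require Import perm generic_quotient fraction.
From mathcomp Require Import ring zify.
From mathcomp Require Import boolp.
From mathcomp.multinomials Require Import freeg.

Set Implicit Arguments.
Unset Strict Implicit.
Unset Printing Implicit Defensive.

Import GRing.Theory.

Local Open Scope ring_scope.
Local Open Scope quotient_scope.

(* The letter (i, false) is x_i and (i, true) is x_i^-1. *)
Notation letter l := ('I_l * bool)%type.
Notation word l := (seq (letter l)).

Definition flip l (a : letter l) : letter l := (a.1, ~~ a.2).
Definition winv l (w : word l) : word l := rev (map (@flip l) w).

Section PresentedGroup.
Context (l : nat) (rels : seq (word l)).

Inductive cong : word l -> word l -> Prop :=
| cong_refl u : cong u u
| cong_sym u v : cong u v -> cong v u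
| cong_trans u v w : cong u v -> cong v w -> cong u w
| cong_cat u u' v v' : cong u u' -> cong v v' -> cong (u ++ v) (u' ++ v')
| cong_cancel a : cong [:: a; flip a] [::]
| cong_rel r : r \in rels -> cong r [::].

Definition congb : rel (word l) := fun u v => `[< cong u v >].

Lemma congb_refl : reflexive congb.
Proof. by move=> u; apply/asboolP/cong_refl. Qed.
Lemma congb_sym : symmetric congb.
Proof. by move=> u v; apply/asboolP/asboolP; exact: cong_sym. Qed.
Lemma congb_trans : transitive congb.
Proof. by move=> v u w /asboolP uv /asboolP vw; apply/asboolP/(cong_trans uv). Qed.

Canonical cong_equiv := EquivRel congb congb_refl congb_sym congb_trans.

Definition fpgroup : Type := {eq_quot cong_equiv}.
HB.instance Definition _ := Choice.on fpgroup.
HB.instance Definition _ := EqQuotient.on fpgroup.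

Definition wclass (w : word l) : fpgroup := \pi_fpgroup w.

Lemma wclassP u v : wclass u = wclass v <-> cong u v.
Proof.
split=> [/eqP|uv]; first by rewrite /wclass eqmodE => /asboolP.
by apply/eqP; rewrite /wclass eqmodE; apply/asboolP.
Qed.

Lemma cong_repr w : cong (repr (wclass w)) w.
Proof. by apply/wclassP; rewrite /wclass reprK. Qed.

Lemma wclassK g : wclass (repr g) = g.
Proof. exact: reprK. Qed.

Lemma flipK : involutive (@flip l).
Proof. by case=> i b; rewrite /flip /= negbK. Qed.

Lemma winvK : involutive (@winv l).
Proof.
by move=> w; rewrite /winv map_rev revK -map_comp map_id_in // => a _ /=; apply: flipK.
Qed.

Lemma cong_winvr w : cong (w ++ winv w) [::].
Proof.
elim: w => [|a w IHw]; first exact: cong_refl.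
rewrite /winv /= rev_cons -cats1 catA -cat1s.
apply: cong_trans (cong_cancel a).
rewrite -[X in cong _ X]/([:: a] ++ [::] ++ [:: flip a]) -!catA.
apply: cong_cat; first exact: cong_refl.
by rewrite catA; apply: cong_cat; [exact: IHw | exact: cong_refl].
Qed.

Lemma cong_winvl w : cong (winv w ++ w) [::].
Proof. by rewrite -{2}[w]winvK; exact: cong_winvr. Qed.

Lemma cong_winv u v : cong u v -> cong (winv u) (winv v).
Proof.
move=> uv; rewrite -[winv u]cats0.
apply: (cong_trans (cong_cat (cong_refl _) (cong_sym (cong_winvr v)))).
rewrite catA -[X in cong _ X]cat0s; apply: cong_cat; last exact: cong_refl.
apply: cong_trans (cong_winvl u).
by apply: cong_cat (cong_sym uv); exact: cong_refl.
Qed.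

Definition fpg_one : fpgroup := wclass [::].
Definition fpg_mul (g h : fpgroup) : fpgroup := wclass (repr g ++ repr h).
Definition fpg_inv (g : fpgroup) : fpgroup := wclass (winv (repr g)).

Lemma fpg_mulE u v : fpg_mul (wclass u) (wclass v) = wclass (u ++ v).
Proof. by apply/wclassP; apply: cong_cat; exact: cong_repr. Qed.

Lemma fpg_invE u : fpg_inv (wclass u) = wclass (winv u).
Proof. by apply/wclassP; apply: cong_winv; exact: cong_repr. Qed.

Lemma fpg_mulA : associative fpg_mul.
Proof.
move=> f g h; rewrite -(wclassK f) -(wclassK g) -(wclassK h).
by rewrite !fpg_mulE catA.
Qed.

Lemma fpg_mul1 : left_id fpg_one fpg_mul.
Proof. by move=> g; rewrite -(wclassK g) fpg_mulE. Qed.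

Lemma fpg_1mul : right_id fpg_one fpg_mul.
Proof. by move=> g; rewrite -(wclassK g) fpg_mulE cats0. Qed.

Lemma fpg_mulV : left_inverse fpg_one fpg_inv fpg_mul.
Proof.
move=> g; rewrite -(wclassK g) fpg_invE fpg_mulE.
by apply/wclassP; exact: cong_winvl.
Qed.

Lemma fpg_Vmul : right_inverse fpg_one fpg_inv fpg_mul.
Proof.
move=> g; rewrite -(wclassK g) fpg_invE fpg_mulE.
by apply/wclassP; exact: cong_winvr.
Qed.

HB.instance Definition _ := isGroup.Build fpgroup
  fpg_mulA fpg_mul1 fpg_1mul fpg_mulV fpg_Vmul.

Lemma wclass_cat u v : wclass (u ++ v) = (wclass u * wclass v)%g.
Proof. by rewrite -fpg_mulE. Qed.

Lemma wclass_nil : wclass [::] = 1%g.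
Proof. by []. Qed.

Lemma wclass_inv u : wclass (winv u) = (wclass u)^-1%g.
Proof. by rewrite -fpg_invE. Qed.

Lemma wclass_rel r : r \in rels -> wclass r = 1%g.
Proof. by move=> rr; apply/wclassP/cong_rel. Qed.

Definition fpgen (i : 'I_l) : fpgroup := wclass [:: (i, false)].

Section Lift.
Context (H : groupType) (f : 'I_l -> H).

Definition weval (w : word l) : H :=
  (\prod_(a <- w) (if a.2 then (f a.1)^-1 else f a.1))%g.

Definition kills_rels : Prop := forall r, r \in rels -> weval r = 1%g.

Definition fplift (fr : kills_rels) (g : fpgroup) : H := weval (repr g).

Context (fr : kills_rels).

Lemma weval_cat u v : weval (u ++ v) = (weval u * weval v)%g.
Proof.
rewrite /weval; elim: u => [|a u IHu] /=; first by rewrite big_nil mul1g.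
by rewrite !big_cons IHu mulgA.
Qed.

Lemma weval_winv w : weval (winv w) = (weval w)^-1%g.
Proof.
elim: w => [|a w IHw]; first by rewrite /weval /= !big_nil invg1.
rewrite /winv /= rev_cons -cats1 weval_cat -/(winv w) IHw.
rewrite /weval !big_cons big_nil mulg1 invgM /=.
by case: a => i [] /=; rewrite ?invgK.
Qed.

Lemma weval_relator u v : weval u = weval v -> weval (u ++ winv v) = 1%g.
Proof. by move=> uv; rewrite weval_cat weval_winv uv mulgV. Qed.

Lemma weval_cong u v : cong u v -> weval u = weval v.
Proof.
elim=> {u v} [//|//|u v w _ -> _ -> //|u u' v v' _ IHu _ IHv|[i b]|r /fr -> //].
- by rewrite !weval_cat IHu IHv.
- by rewrite /weval !big_cons big_nil mulg1; case: b; rewrite ?mulVg ?mulgV.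
- by rewrite /weval big_nil.
Qed.

Lemma fplift_wclass w : fplift fr (wclass w) = weval w.
Proof. by apply: weval_cong; exact: cong_repr. Qed.

Lemma fpliftM : {morph fplift fr : g h / (g * h)%g}.
Proof.
move=> g h; rewrite -(wclassK g) -(wclassK h) -wclass_cat.
by rewrite !fplift_wclass weval_cat.
Qed.

HB.instance Definition _ :=
  isMultiplicative.Build fpgroup H (fplift fr) fpliftM.

Lemma fplift_gen i : fplift fr (fpgen i) = f i.
Proof. by rewrite fplift_wclass /weval big_cons big_nil mulg1. Qed.

End Lift.
End PresentedGroup.

Arguments wclass {l} rels w.
Arguments fpgen {l} rels i.

Definition freegroup (l : nat) : groupType := fpgroup ([::] : seq (word l)).

Record presentation := Presentation {
  ngen : nat;
  relators : seq (word ngen)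
}.

Section Presentation.
Context (P : presentation).

Definition nrel : nat := size (relators P).

Definition relator (i : 'I_nrel) : freegroup (ngen P) :=
  wclass [::] (tnth (in_tuple (relators P)) i).

Definition group_of : groupType := fpgroup (relators P).

Lemma fpgen_kills_nil : kills_rels [::] (fpgen (relators P) : _ -> group_of).
Proof. by []. Qed.

Definition fproj : freegroup (ngen P) -> group_of := fplift fpgen_kills_nil.
HB.instance Definition _ := Multiplicative.on fproj.

End Presentation.

(* The integral group ring Z[G] as the free abelian group on G; only its left
   G-module structure is used. *)
Notation "'Z[ G ]" := {freeg G / int}
  (at level 0, G at level 2, format "''Z[' G ]") : type_scope.

(* Z-linear extension of h; V is seen as a Z-module through zmodule. *)
Section LinearExtension.
Context (K : choiceType) (V : zmodType) (h : K -> V).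
Implicit Types x y : {freeg K / int}.

Definition linext x : V := @fglift int (zmodule V) K h x.

Lemma linextB x y : linext (x - y) = linext x - linext y.
Proof. exact: (@lift_is_additive int K (zmodule V) h). Qed.

HB.instance Definition _ :=
  GRing.isZmodMorphism.Build {freeg K / int} V linext linextB.

Lemma linext0 : linext 0 = 0. Proof. exact: raddf0. Qed.
Lemma linextN x : linext (- x) = - linext x. Proof. exact: raddfN. Qed.
Lemma linextD x y : linext (x + y) = linext x + linext y.
Proof. exact: raddfD. Qed.

Lemma linextU k : linext << k >> = h k.
Proof. by rewrite /linext liftU scale1r. Qed.

Lemma linextE x : linext x = \sum_(k <- dom x) h k *~ coeff k x.
Proof.
rewrite -[x in LHS]freeg_sumE raddf_sum; apply: eq_bigr => k _.
by rewrite /= /linext liftU.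
Qed.

End LinearExtension.

Lemma linext_comp (K K' : choiceType) (V : zmodType)
    (h : K -> {freeg K' / int}) (h' : K' -> V) x :
  linext h' (linext h x) = linext (fun k => linext h' (h k)) x.
Proof.
rewrite [linext h x]linextE [RHS]linextE raddf_sum.
by apply: eq_bigr => k _; rewrite raddfMz.
Qed.

Section LeftTranslation.
Context (G : groupType).
Implicit Types (g h : G) (x y : 'Z[G]).

Definition lmulg g : 'Z[G] -> 'Z[G] := linext (fun h => << (g * h)%g >>).

Lemma lmulg0 g : lmulg g 0 = 0. Proof. exact: linext0. Qed.
Lemma lmulgN g x : lmulg g (- x) = - lmulg g x. Proof. exact: linextN. Qed.
Lemma lmulgD g x y : lmulg g (x + y) = lmulg g x + lmulg g y.
Proof. exact: linextD. Qed.

Lemma lmulgU g h : lmulg g << h >> = << (g * h)%g >>.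
Proof. exact: linextU. Qed.

Lemma lmulgM g h x : lmulg (g * h)%g x = lmulg g (lmulg h x).
Proof.
rewrite /lmulg linext_comp !linextE; apply: eq_bigr => k _.
by rewrite linextU mulgA.
Qed.

Lemma lmul1g x : lmulg 1%g x = x.
Proof.
rewrite -[RHS]freeg_sumE /lmulg linextE; apply: eq_bigr => k _.
by rewrite mul1g freegU_mulz intz.
Qed.

End LeftTranslation.

Section Fox.
Context (l : nat) (j : 'I_l).

Definition fgen (i : 'I_l) : freegroup l := fpgen [::] i.
Definition fclass (w : word l) : freegroup l := wclass [::] w.

Lemma fclass_cat u v : fclass (u ++ v) = (fclass u * fclass v)%g.
Proof. exact: wclass_cat. Qed.

(* d x_i / d x_j = delta_ij forces d x_i^-1 / d x_j = - delta_ij x_i^-1. *)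
Definition fox_letter (a : letter l) : 'Z[freegroup l] :=
  if a.1 == j then
    (if a.2 then - << (fgen a.1)^-1%g >> else << 1%g >>)
  else 0.

Fixpoint fox_word (w : word l) : 'Z[freegroup l] :=
  if w is a :: w' then fox_letter a + lmulg (fclass [:: a]) (fox_word w')
  else 0.

Definition fox (g : freegroup l) : 'Z[freegroup l] := fox_word (repr g).

Lemma fox_word_cat u v :
  fox_word (u ++ v) = fox_word u + lmulg (fclass u) (fox_word v).
Proof.
elim: u => [|a u IHu] /=; first by rewrite lmul1g add0r.
have cE : fclass (a :: u) = (fclass [:: a] * fclass u)%g by exact: (fclass_cat [:: a]).
by rewrite IHu lmulgD cE [lmulg (_ * _)%g _](lmulgM (fclass [:: a]) (fclass u)) addrA.
Qed.

Lemma fox_word_cong u v : cong [::] u v -> fox_word u = fox_word v.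
Proof.
elim=> {u v} [//|//|u v w _ -> _ -> //|u u' v v' uu' IHu _ IHv|[i b]|//].
  have uuE : fclass u = fclass u' by apply/wclassP.
  by rewrite !fox_word_cat IHu IHv uuE.
rewrite /= lmulg0 addr0 /fox_letter /=; case: eqP => _; last first.
  by rewrite lmulg0 addr0.
have xV : fclass [:: (i, true)] = (fgen i)^-1%g by rewrite -wclass_inv.
case: b => /=; first by rewrite lmulgU mulg1 xV addrC subrr.
by rewrite lmulgN lmulgU mulgV subrr.
Qed.

Lemma fox_fclass w : fox (fclass w) = fox_word w.
Proof. by apply: fox_word_cong; exact: cong_repr. Qed.

Lemma fox_gen i : fox (fgen i) = if i == j then << 1%g >> else 0.
Proof. by rewrite fox_fclass /= lmulg0 addr0. Qed.

Lemma fclassK (g : freegroup l) : fclass (repr g) = g.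
Proof. exact: wclassK. Qed.

Lemma foxM g h : fox (g * h)%g = fox g + lmulg g (fox h).
Proof.
by rewrite -(fclassK g) -(fclassK h) -fclass_cat !fox_fclass fox_word_cat.
Qed.

End Fox.

(* Laurent polynomials: R[z, z^-1] is realised inside Frac(R[z]) as the set of
   x such that z^k x is a polynomial for some k. *)

Notation tofrac := (@FracField.tofrac _).
Notation "x %:F" := (tofrac x) : ring_scope.

Section Laurent.
Context (R : idomainType).

Definition laurent_pred : {pred {fraction {poly R}}} :=
  fun x => `[< exists k (p : {poly R}), x * ('X^k)%:F = p%:F >].

Lemma laurent_subring : subring_closed laurent_pred.
Proof.
split; first by apply/asboolP; exists 0%N, 1; rewrite expr0 mulr1.
  move=> x y /asboolP[k [p Hp]] /asboolP[m [q Hq]]; apply/asboolP.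
  exists (k + m)%N, (p * 'X^m - q * 'X^k).
  by rewrite exprD tofracB !tofracM -Hp -Hq; ring.
move=> x y /asboolP[k [p Hp]] /asboolP[m [q Hq]]; apply/asboolP.
by exists (k + m)%N, (p * q); rewrite exprD !tofracM -Hp -Hq; ring.
Qed.

HB.instance Definition _ :=
  GRing.isSubringClosed.Build {fraction {poly R}} laurent_pred laurent_subring.

Record laurent := Laurent {
  lfrac : {fraction {poly R}};
  lfracP : lfrac \in laurent_pred
}.

HB.instance Definition _ := [isSub for lfrac].
HB.instance Definition _ := [Choice of laurent by <:].
HB.instance Definition _ := [SubChoice_isSubComNzRing of laurent by <:].

Definition lunit : {pred laurent} := fun x => `[< exists y, y * x = 1 >].
Definition linv (x : laurent) : laurent :=
  if pselect (exists y, y * x = 1) is left h then projT1 (cid h) else x.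

Lemma lmulVx : {in lunit, left_inverse 1 linv *%R}.
Proof.
move=> x /asboolP xu; rewrite /linv; case: pselect => [h|//].
exact: projT2 (cid h).
Qed.

Lemma lunitPl (x y : laurent) : y * x = 1 -> lunit x.
Proof. by move=> yx; apply/asboolP; exists y. Qed.

Lemma linv_out : {in [predC lunit], linv =1 id}.
Proof.
move=> x /negP xu; rewrite /linv; case: pselect => // h.
by case: xu; apply/asboolP.
Qed.

HB.instance Definition _ :=
  GRing.ComNzRing_hasMulInverse.Build laurent lmulVx lunitPl linv_out.

Lemma laurent_integral : GRing.integral_domain_axiom laurent.
Proof.
move=> x y /(congr1 val); rewrite rmorphM rmorph0 /= => /eqP.
by rewrite mulf_eq0 -!(inj_eq val_inj) rmorph0.
Qed.

HB.instance Definition _ :=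
  GRing.ComUnitRing_isIntegral.Build laurent laurent_integral.

Fact lpoly_subproof (p : {poly R}) : p%:F \in laurent_pred.
Proof. by apply/asboolP; exists 0%N, p; rewrite expr0 mulr1. Qed.

Definition lpoly (p : {poly R}) : laurent := Laurent (lpoly_subproof p).

Lemma lpoly_is_zmod_morphism : zmod_morphism lpoly.
Proof. by move=> p q; apply: val_inj; rewrite rmorphB /= tofracB. Qed.

Lemma lpoly_is_monoid_morphism : monoid_morphism lpoly.
Proof.
split; first by apply: val_inj; rewrite rmorph1 /= tofrac1.
by move=> p q; apply: val_inj; rewrite rmorphM /= tofracM.
Qed.

HB.instance Definition _ :=
  GRing.isZmodMorphism.Build {poly R} laurent lpoly lpoly_is_zmod_morphism.
HB.instance Definition _ :=
  GRing.isMonoidMorphism.Build {poly R} laurent lpoly lpoly_is_monoid_morphism.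

Definition lC (a : R) : laurent := lpoly a%:P.
Definition lX : laurent := lpoly 'X.

Lemma lX_unit : lX \is a GRing.unit.
Proof.
have zX : ('X : {poly R})%:F != 0 by rewrite tofrac_eq0 polyX_eq0.
have Xi : ('X : {poly R})%:F^-1 \in laurent_pred.
  by apply/asboolP; exists 1%N, 1; rewrite expr1 mulVf.
apply/asboolP; exists (Laurent Xi); apply: val_inj.
by rewrite rmorphM /= mulVf.
Qed.

End Laurent.

Arguments lX {R}.
Arguments lC {R} a.

Section GL.
Context (R : comUnitRingType) (N : nat).

Record GL := MkGL { glmx :> 'M[R]_N; glmxP : glmx \in unitmx }.

HB.instance Definition _ := [isSub for glmx].
HB.instance Definition _ := [Choice of GL by <:].

Fact gl_mul_subproof (A B : GL) : A *m B \in unitmx.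
Proof. by rewrite unitmx_mul !glmxP. Qed.

Fact gl_inv_subproof (A : GL) : invmx A \in unitmx.
Proof. by rewrite unitmx_inv glmxP. Qed.

Definition gl_one : GL := MkGL (unitmx1 R N).
Definition gl_mul (A B : GL) : GL := MkGL (gl_mul_subproof A B).
Definition gl_inv (A : GL) : GL := MkGL (gl_inv_subproof A).

Fact gl_mulA : associative gl_mul.
Proof. by move=> A B C; apply: val_inj; exact: mulmxA. Qed.
Fact gl_mul1 : left_id gl_one gl_mul.
Proof. by move=> A; apply: val_inj; exact: mul1mx. Qed.
Fact gl_1mul : right_id gl_one gl_mul.
Proof. by move=> A; apply: val_inj; exact: mulmx1. Qed.
Fact gl_mulV : left_inverse gl_one gl_inv gl_mul.
Proof. by move=> A; apply: val_inj; apply: mulVmx; exact: glmxP. Qed.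
Fact gl_Vmul : right_inverse gl_one gl_inv gl_mul.
Proof. by move=> A; apply: val_inj; apply: mulmxV; exact: glmxP. Qed.

HB.instance Definition _ := isGroup.Build GL
  gl_mulA gl_mul1 gl_1mul gl_mulV gl_Vmul.

End GL.

(* The group Z = <z>, written multiplicatively: c : Zcyc stands for z^c. *)
Definition Zcyc : Type := int.
HB.instance Definition _ := Choice.on Zcyc.
HB.instance Definition _ := isGroup.Build Zcyc
  (@addrA int) (@add0r int) (@addr0 int) (@addNr int) (@addrN int).

Definition divides (A : comNzRingType) (d x : A) : Prop := exists q, x = q * d.

Definition is_gcd (A : comNzRingType) (S : A -> Prop) (g : A) : Prop :=
  (forall x, S x -> divides g x) /\
  (forall d, (forall x, S x -> divides d x) -> divides d g).

Section TwistedAlexander.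
Context (R : idomainType) (P : presentation) (N : nat).
Context (rho : {multiplicative group_of P -> GL R N}).
Context (alpha : {multiplicative group_of P -> Zcyc}).

Definition twist (g : group_of P) : 'M[laurent R]_N :=
  (lX ^ (alpha g : int)) *: map_mx lC (rho g).

Definition Phi : 'Z[freegroup (ngen P)] -> 'M[laurent R]_N :=
  linext (fun w : freegroup (ngen P) => twist (fproj w)).

Definition wada_denom (j : 'I_(ngen P)) : laurent R :=
  \det (Phi (<< 1%g >> - << fgen j >>)).

(* lift j skips the j-th generator: this is the Fox matrix M without its j-th
   block column. *)
Definition fox_mx (j : 'I_(ngen P)) :
    'M[laurent R]_(\sum_(i < nrel P) N, \sum_(k < (ngen P).-1) N) :=
  \mxblock_(i < nrel P, k < (ngen P).-1) Phi (fox (fintype.lift j k) (relator i)).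

(* When there are fewer than (l-1)N rows no f exists, and the gcd of the empty
   set is 0, in accordance with the convention Delta = 0 for m < l - 1. *)
Definition is_minor (j : 'I_(ngen P)) (d : laurent R) : Prop :=
  exists f : 'I_(\sum_(k < (ngen P).-1) N) -> 'I_(\sum_(i < nrel P) N),
    {homo f : a b / (a < b)%N} /\ d = \det (rowsub f (fox_mx j)).

(* Wada's quotient is only defined up to units and a choice of j, so it is given
   as a predicate on the fraction Delta.  Unique factorization in R serves only
   to ensure that the gcd exists, and is not required here. *)
Definition is_twisted_alexander (Delta : {fraction (laurent R)}) : Prop :=
  (forall c : Zcyc, exists g, alpha g = c) /\
  exists j g, [/\ wada_denom j != 0, is_gcd (is_minor j) g
                & Delta = g%:F / (wada_denom j)%:F].

End TwistedAlexander.

Definition eq_up_to_units (R : idomainType) (f g : {fraction (laurent R)}) :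
    Prop :=
  exists (eps : R) (c : int),
    eps \is a GRing.unit /\ f = (lC eps * lX ^ c)%:F * g.

(* sigma_(i+1) is the generator of index i : 'I_n.-1. *)

Section Braid.
Context (n : nat).

Definition sigma (i : 'I_n.-1) : word n.-1 := [:: (i, false)].

Definition comm_relator (i j : 'I_n.-1) : word n.-1 :=
  (sigma i ++ sigma j) ++ winv (sigma j ++ sigma i).

Definition braid_relator (i j : 'I_n.-1) : word n.-1 :=
  (sigma i ++ sigma j ++ sigma i) ++ winv (sigma j ++ sigma i ++ sigma j).

Definition braid_presentation : presentation := @Presentation n.-1
  ([seq comm_relator p.1 p.2 | p in [pred p : 'I_n.-1 * 'I_n.-1 | (p.1.+1 < p.2)%N]]
   ++ [seq braid_relator p.1 p.2
        | p in [pred p : 'I_n.-1 * 'I_n.-1 | p.1.+1 == p.2 :> nat]]).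

Definition braid_group : groupType := group_of braid_presentation.

Lemma braid_kills (H : groupType) (f : 'I_n.-1 -> H) :
  (forall i j : 'I_n.-1, (i.+1 < j)%N -> f i * f j = f j * f i)%g ->
  (forall i j : 'I_n.-1, i.+1 = j ->
     f i * f j * f i = f j * f i * f j)%g ->
  kills_rels (relators braid_presentation) f.
Proof.
move=> fcomm fbraid r; rewrite mem_cat => /orP[] /imageP[[i j] /= ij ->];
  apply: weval_relator; rewrite /weval !big_cons !big_nil /= ?mulg1.
  exact: fcomm.
by rewrite !mulgA; apply: fbraid; apply/eqP.
Qed.

Lemma braid_ab_subproof :
  kills_rels (relators braid_presentation) (fun=> (1 : int) : Zcyc).
Proof. by apply: braid_kills. Qed.

Definition braid_ab : {multiplicative braid_group -> Zcyc} :=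
  fplift braid_ab_subproof.

Lemma braid_ab_gen i : braid_ab (fpgen _ i) = (1 : int).
Proof. exact: fplift_gen. Qed.

(* The direct sum of I_i, [0 1; t 0] and I_(n-i-2), with i counted from 0. *)
Definition tym_mx (i : 'I_n.-1) : 'M[laurent int]_n :=
  \matrix_(a < n, b < n)
    if a == i :> nat then (b == i.+1 :> nat)%:R
    else if a == i.+1 :> nat then lX *+ (b == i :> nat)
    else (a == b)%:R.

Definition monomx (s : 'I_n -> 'I_n) (c : 'I_n -> laurent int) : 'M[laurent int]_n :=
  \matrix_(a < n, b < n) (c a *+ (b == s a)).

Lemma monomx_mul s c s' c' :
  monomx s c *m monomx s' c' = monomx (s' \o s) (fun a => c a * c' (s a)).
Proof.
apply/matrixP => a b; rewrite !mxE (bigD1 (s a)) //= big1 => [|k /negPf ks].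
  by rewrite addr0 !mxE eqxx mulr1n mulrnAr.
by rewrite !mxE ks mul0r.
Qed.

Lemma eq_monomx s c s' c' : s =1 s' -> c =1 c' -> monomx s c = monomx s' c'.
Proof. by move=> ss cc; apply/matrixP => a b; rewrite !mxE ss cc. Qed.

Lemma ltn_ordpred (i : 'I_n.-1) : (i.+1 < n)%N.
Proof. by case: n i => [|m] [i] //=. Qed.

Definition tym_perm (i : 'I_n.-1) : 'I_n -> 'I_n :=
  tperm (Ordinal (ltnW (ltn_ordpred i))) (Ordinal (ltn_ordpred i)).

Lemma tym_permK i : involutive (tym_perm i).
Proof. exact: tpermK. Qed.

Lemma tym_permE i a : tym_perm i a = (if a == i :> nat then i.+1 else
  if a == i.+1 :> nat then (i : nat) else (a : nat))%N :> nat.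
Proof.
rewrite /tym_perm; case: tpermP => [->|->|/eqP + /eqP]; rewrite /= ?eqxx //.
  by rewrite gtn_eqF.
by rewrite -!val_eqE /= => /negPf -> /negPf ->.
Qed.

Lemma tym_mxE i : tym_mx i =
  monomx (tym_perm i) (fun a => if a == i.+1 :> nat then lX else 1).
Proof.
apply/matrixP => a b; rewrite !mxE -[b == tym_perm i a]val_eqE /= tym_permE.
have [ai|nai] := eqVneq (a : nat) i; first by rewrite ai (@ltn_eqF i).
by have [ai|nai'] := eqVneq (a : nat) i.+1; rewrite // eq_sym.
Qed.

Fact tym_mx_unit i : tym_mx i \in unitmx.
Proof.
pose ti := monomx (tym_perm i) (fun a => if a == i :> nat then lX^-1 else 1).
suff /mulmx1_unit[] : tym_mx i *m ti = 1%:M by [].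
rewrite tym_mxE monomx_mul.
apply/matrixP => a b; rewrite !mxE /= tym_permK [b == a]eq_sym; congr (_ *+ _).
rewrite tym_permE; have [ai|nai] := eqVneq (a : nat) i.
  by rewrite ai (@ltn_eqF i) // gtn_eqF // mul1r.
have [ai|nai'] := eqVneq (a : nat) i.+1; last by rewrite (negPf nai) mul1r.
by rewrite eqxx divrr ?lX_unit.
Qed.

Definition tym_gl (i : 'I_n.-1) : GL (laurent int) n := MkGL (tym_mx_unit i).

Ltac split_ifs := repeat match goal with
  | |- context [if ?b then _ else _] =>
      lazymatch b with context [if _ then _ else _] => fail | _ => idtac end;
      case: (boolP b) => ?
  end.

Lemma tym_comm (i j : 'I_n.-1) : (i.+1 < j)%N ->
  (tym_gl i * tym_gl j = tym_gl j * tym_gl i)%g.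
Proof.
move=> ij; apply: val_inj; rewrite /= !tym_mxE !monomx_mul.
apply: eq_monomx => a; last first.
  by rewrite /= !tym_permE; split_ifs; rewrite ?mulr1 ?mul1r //; exfalso; lia.
by apply: val_inj; rewrite /= !tym_permE; split_ifs; lia.
Qed.

Lemma tym_braid (i j : 'I_n.-1) : i.+1 = j ->
  (tym_gl i * tym_gl j * tym_gl i = tym_gl j * tym_gl i * tym_gl j)%g.
Proof.
move=> ij; apply: val_inj; rewrite /= !tym_mxE !monomx_mul.
apply: eq_monomx => a; last first.
  rewrite /= !tym_permE -ij.
  by split_ifs; rewrite ?mulr1 ?mul1r //; exfalso; lia.
by apply: val_inj; rewrite /= !tym_permE -ij; split_ifs; lia.
Qed.

Definition TYM : {multiplicative braid_group -> GL (laurent int) n} :=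
  fplift (braid_kills tym_comm tym_braid).

Lemma TYM_gen i : TYM (fpgen _ i) = tym_mx i :> 'M[laurent int]_n.
Proof. by rewrite [TYM _]fplift_gen. Qed.

End Braid.

(* Main.v *)
From HB Require Import structures.
From mathcomp Require Import all_boot all_order all_algebra.
From mathcomp Require Import perm fraction.
From mathcomp Require Import ring zify.
From mathcomp Require Import boolp.
From mathcomp.multinomials Require Import freeg.
Require Import Defs.

Set Implicit Arguments.
Unset Strict Implicit.
Unset Printing Implicit Defensive.

Import GRing.Theory.

Local Open Scope ring_scope.

(* For block columns indexed by the generators, let A be the cokernel of the Fox matrix
   M, and let Z be the block column of the 1 - Phi(x_k), so that M Z = 0.  For any N rows
   Y, with X = Y Z, eliminating the j-th block column by means of Z gives
     det [Y; C M] det Phi(1 - x_j) = det X det (C M_j)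
   for every C.  In the braid group Y can be chosen with det X equal, up to units, to
   1 - z or to 1 - t z^2; these are coprime, so det Phi(1 - x_j) divides every minor.
   Conversely, if u annihilates A / Y, then every common divisor of the minors divides a
   power of u times det Phi(1 - x_j).  For n >= 4 the first choice of Y allows
   u = (z - 1) (z^2 - z + 1), the second u = (1 - t z^2) (1 + t z^3), and these are
   again coprime, so the gcd is det Phi(1 - x_j).  For n = 3 there is one relator and
   hence one minor, a 3 x 3 determinant.  Coprimality is used in the form "v is regular
   modulo u", for which no unique factorization is needed. *)

(** * Divisibility in Laurent polynomial rings *)

Section Divides.
Context (A : idomainType).
Implicit Types u v w d x y q : A.

Lemma divides_mull d x y : divides d y -> divides d (x * y).
Proof. by move=> [q ->]; exists (x * q); rewrite mulrA. Qed.

Lemma divides_sum d (I : finType) (F : I -> A) :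
  (forall i, divides d (F i)) -> divides d (\sum_i F i).
Proof.
move=> dF; elim/big_ind: _ => [|x y [q ->] [r ->]|i _]; last exact: dF.
  by exists 0; rewrite mul0r.
by exists (q + r); rewrite mulrDl.
Qed.

Definition regular_mod u v := forall q, divides u (v * q) -> divides u q.

(** If u x = q d and v x = r d, then v q = u r, so u divides q by regularity; cancelling u shows
    that d divides x. *)
Lemma divides_coprime u v d x : u != 0 -> d != 0 -> regular_mod u v ->
  divides d (u * x) -> divides d (v * x) -> divides d x.
Proof.
move=> u0 d0 uv [q qE] [r rE].
have [] := uv q.
  exists r; apply: (mulIf d0); rewrite -mulrA -qE.
  by rewrite mulrCA rE; ring.
move=> s sE; exists s; apply: (mulfI u0); rewrite qE sE; ring.
Qed.

Lemma regular_modM u v w : regular_mod u v -> regular_mod u w ->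
  regular_mod u (v * w).
Proof. by move=> uv uw q; rewrite -mulrA => /uv/uw. Qed.

Lemma regular_Mmod u v w : u != 0 -> regular_mod u w -> regular_mod v w ->
  regular_mod (u * v) w.
Proof.
move=> u0 uw vw q [r rE].
have [|q' q'E] := uw q; first by exists (r * v); rewrite rE; ring.
have [|s sE] := vw q'; last by exists s; rewrite q'E sE; ring.
by exists r; apply: (mulfI u0); rewrite mulrCA (mulrC u) -q'E rE; ring.
Qed.

Lemma regular_modX u v k m : u != 0 -> regular_mod u v ->
  regular_mod (u ^+ k) (v ^+ m).
Proof.
move=> u0 uv; elim: k => [|k IHk].
  by move=> q _; exists q; rewrite expr0 mulr1.
rewrite exprS; apply: regular_Mmod => //; elim: m {IHk} => [|m IHm].
  by move=> q; rewrite expr0 mul1r.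
by rewrite exprS; apply: regular_modM.
Qed.

(** Modulo u the product b v is c, so whatever v kills is killed by c as well. In the applications c
    is a nonzero constant in z. *)
Lemma regular_bezout u v c a b : a * u + b * v = c ->
  regular_mod u c -> regular_mod u v.
Proof.
move=> <- uc q [r rE]; apply: uc; exists (a * q + b * r).
by rewrite mulrDl -[b * v * q]mulrA rE; ring.
Qed.

Lemma gcd_unique (S : A -> Prop) g h : is_gcd S g -> is_gcd S h ->
  exists2 e, e \is a GRing.unit & g = e * h.
Proof.
move=> [gS gmax] [hS hmax]; have [e hE] := hmax _ gS; have [e' gE] := gmax _ hS.
have [h0|h0] := eqVneq h 0.
  by exists 1; rewrite ?unitr1 // gE h0 !mulr0.
have ee : e * e' = 1.
  by apply: (mulIf h0); rewrite mul1r [RHS]hE gE mulrA.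
by exists e' => //; apply/unitrPr; exists e; rewrite mulrC.
Qed.

End Divides.

(** * Torsion and units in Laurent polynomial rings *)

HB.instance Definition _ (R : idomainType) :=
  GRing.RMorphism.copy (@lC R) (@lpoly R \o polyC).

Section LaurentLemmas.
Context (R : idomainType).
Implicit Types (x y : laurent R) (p q : {poly R}).

Lemma lpoly_inj : injective (@lpoly R).
Proof. by move=> p q /(congr1 val) /eqP; rewrite /= tofrac_eq => /eqP. Qed.

Lemma lpoly_eq0 p : (lpoly p == 0) = (p == 0).
Proof. by rewrite -(inj_eq lpoly_inj) rmorph0. Qed.

Lemma laurent_lift x : exists k p, x * lX ^+ k = lpoly p.
Proof.
have /asboolP[k [p xE]] := lfracP x; exists k, p; apply: val_inj.
by rewrite /lX -rmorphXn rmorphM.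
Qed.

(* Division with remainder by the monic p makes R[z, z^-1] / p torsion-free over R. *)
Lemma regular_monic p (c : R) : p \is monic -> c != 0 ->
  regular_mod (lpoly p) (lC c).
Proof.
move=> pm c0 q [r rE].
have [k [Q QE]] := laurent_lift q; have [m [S SE]] := laurent_lift r.
have /lpoly_inj : lpoly (c%:P * (Q * 'X^m)) = lpoly (S * 'X^k * p).
  rewrite !rmorphM !rmorphXn /= -QE -SE.
  transitivity (lC c * q * lX ^+ k * lX ^+ m); first by rewrite /lC /lX; ring.
  by rewrite rE /lX; ring.
rewrite mul_polyC => QS.
have cQ := Pdiv.RingMonic.rdivp_eq pm (Q * 'X^m).
have := congr1 (fun P => Pdiv.Ring.rmodp (c *: P) p) cQ.
rewrite QS Pdiv.RingMonic.rmodp_mull // scalerDr scalerAl.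
rewrite Pdiv.RingMonic.rmodp_addl_mul_small //; last first.
  by rewrite size_scale // Pdiv.Ring.ltn_rmodpN0 // monic_neq0.
move=> /esym/eqP; rewrite scale_poly_eq0 (negPf c0) /= => /eqP rem0.
rewrite rem0 addr0 in cQ.
exists (lpoly (Pdiv.Ring.rdivp (Q * 'X^m) p) / (lX ^+ k * lX ^+ m)).
have Xu : (lX ^+ k * lX ^+ m : laurent R) \is a GRing.unit.
  by rewrite unitrM !unitrX ?lX_unit.
apply: (mulIr Xu); rewrite mulrAC divrK // -rmorphM -cQ rmorphM rmorphXn /= -QE /lX.
by ring.
Qed.

(** At 0 one of the two factors vanishes and gives up a factor X. When no power of X is left, p is a
    unit, hence a constant. *)
Lemma poly_mul_eqXn p q k : p * q = 'X^k ->
  exists2 a, a \is a GRing.unit & exists m, p = a *: 'X^m.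
Proof.
elim: k p q => [|k IHk] p q pq.
  have /eqP := pq; rewrite expr0 -[_ == _]andbT => /andP[/eqP pq1 _].
  have : p \is a GRing.unit by apply/unitrPr; exists q.
  rewrite poly_unitE => /andP[/size_poly1P[a _ pE]].
  by rewrite pE coefC eqxx => au; exists a => //; exists 0%N; rewrite expr0 alg_polyC.
have : p.[0] * q.[0] == 0 by rewrite -hornerM pq hornerXn expr0n.
have rootX (P : {poly R}) : P.[0] == 0 -> exists P', P = P' * 'X.
  by move=> /factor_theorem[P']; rewrite subr0; exists P'.
rewrite mulf_eq0 => /orP[] /rootX[r rE].
  have /IHk[a au [m mE]] : r * q = 'X^k.
    by apply: (mulIf (monic_neq0 (monicX R))); rewrite -exprSr -pq rE; ring.
  by exists a => //; exists m.+1; rewrite rE mE -scalerAl -exprSr.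
by apply: (IHk _ r); apply: (mulIf (monic_neq0 (monicX R))); rewrite -exprSr -pq rE; ring.
Qed.

(** Clearing denominators in x y = 1 gives p q = X^(k+m). The result is the form of units that
    [eq_up_to_units] asks for. *)
Lemma laurent_unitP x : x \is a GRing.unit ->
  exists (eps : R) (c : int), eps \is a GRing.unit /\ x = lC eps * lX ^ c.
Proof.
move=> /unitrPr[y xy].
have [k [p pE]] := laurent_lift x; have [m [q qE]] := laurent_lift y.
have [|a au [i iE]] := @poly_mul_eqXn p q (k + m).
  apply: lpoly_inj; rewrite rmorphM rmorphXn /= -pE -qE exprD -/lX.
  by transitivity (x * y * (lX ^+ k * lX ^+ m)); [ring | rewrite xy mul1r].
exists a, (i%:Z - k%:Z); split=> //.
rewrite exprzDr ?lX_unit // -exprnP -exprnN.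
have Xu : (lX ^+ k : laurent R) \is a GRing.unit by rewrite unitrX ?lX_unit.
by apply: (mulIr Xu); rewrite pE iE mulrA divrK // -mul_polyC rmorphM rmorphXn.
Qed.

End LaurentLemmas.

(** * Minors *)

Section Determinants.

(** Sorting the values of [f] gives [g]; injectivity makes it strictly increasing. *)
Lemma rowsub_increasing_perm p q (f : 'I_p -> 'I_q) : injective f ->
  exists (g : 'I_p -> 'I_q) (s : 'S_p),
    {homo g : a b / (a < b)%N} /\ forall a, g a = f (s a).
Proof.
move=> f_inj; pose t := [tuple f a | a < p].
pose leqo := fun a b : 'I_q => (a <= b)%N.
have /tuple_permP[s sE] : perm_eq (sort leqo t) t by rewrite perm_sort.
exists (fun a => f (s a)), s; split=> // a b ab.
have size_t : size (sort leqo t) = p by rewrite size_sort size_tuple.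
have nthE (c : 'I_p) : nth (f a) (sort leqo t) c = f (s c).
  by rewrite sE -tnth_nth !tnth_mktuple.
rewrite ltn_neqAle; apply/andP; split.
  by apply: contraTneq ab => /val_inj/f_inj/perm_inj ->; rewrite ltnn.
rewrite -!nthE; apply: (@sorted_leq_nth _ leqo) => //; rewrite ?inE ?size_t //.
- by move=> ? ? ?; apply: leq_trans.
- by apply: sort_sorted => ? ?; apply: leq_total.
- exact: ltnW.
Qed.

(** Cauchy-Binet before the maps are grouped by image: the rows of the product are expanded
    multilinearly, so [f] runs over all maps. *)
Lemma det_mulmx_rowsub (A : comNzRingType) p q (C : 'M[A]_(p, q)) (M : 'M[A]_(q, p)) :
  \det (C *m M) = \sum_(f : {ffun 'I_p -> 'I_q}) (\prod_i C i (f i)) * \det (rowsub f M).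
Proof.
rewrite /determinant.
under eq_bigr => s _.
  under eq_bigr => i _ do rewrite mxE.
  rewrite bigA_distr_bigA big_distrr /=; over.
rewrite exchange_big /=; apply: eq_bigr => f _; rewrite big_distrr.
apply: eq_bigr => s _ /=; rewrite big_split /= mulrCA; congr (_ * (_ * _)).
by apply: eq_bigr => i _; rewrite mxE.
Qed.

Context (A : idomainType).

(** Wada's minors use increasing choices of rows only. An injective choice differs from one of these
    by a sign, and any other repeats a row. *)
Lemma divides_det_rowsub p q (M : 'M[A]_(q, p)) d :
  (forall f : 'I_p -> 'I_q, {homo f : a b / (a < b)%N} ->
     divides d (\det (rowsub f M))) ->
  forall f : 'I_p -> 'I_q, divides d (\det (rowsub f M)).
Proof.
move=> dM f; have [f_inj|] := boolP (injectiveb f).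
  have [g [s [g_incr gE]]] := rowsub_increasing_perm (injectiveP _ f_inj).
  have -> : rowsub f M = row_perm s^-1 (rowsub g M).
    by apply/matrixP=> a b; rewrite !mxE gE permKV.
  by rewrite row_permE det_mulmx; apply/divides_mull/dM.
move=> /injectivePn[a [b ab fab]].
have -> : \det (rowsub f M) = 0.
  by apply: (determinant_alternate ab) => c; rewrite !mxE fab.
by exists 0; rewrite mul0r.
Qed.

Lemma divides_det_mulmx p q (C : 'M[A]_(p, q)) (M : 'M[A]_(q, p)) d :
  (forall f : 'I_p -> 'I_q, divides d (\det (rowsub f M))) ->
  divides d (\det (C *m M)).
Proof.
by move=> dM; rewrite det_mulmx_rowsub; apply: divides_sum => f; apply/divides_mull/dM.
Qed.

(** Laplace expansion along the columns of [B], one at a time, ends with determinants of products of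
    the form [C *m M]. *)
Lemma divides_det_row_mx p q (M : 'M[A]_(q, p)) d :
  (forall f : 'I_p -> 'I_q, divides d (\det (rowsub f M))) ->
  forall k (B : 'M[A]_(k + p, k)) (C : 'M[A]_(k + p, q)),
  divides d (\det (row_mx B (C *m M))).
Proof.
move=> dM; elim=> [|k IHk] B C.
  have -> : row_mx B (C *m M) = C *m M :> 'M_p.
    apply/matrixP=> a b; rewrite mxE; case: splitP => [[]//|b' bE].
    by congr ((C *m M) a _); apply: val_inj.
  exact: divides_det_mulmx.
rewrite (expand_det_col _ (ord0 : 'I_(k + p).+1)); apply: divides_sum => i.
apply: divides_mull; rewrite /cofactor; apply: divides_mull.
pose B' : 'M_(k + p, k) := row' (i : 'I_(k + p).+1) (\matrix_(a, b) B a (fintype.lift ord0 b)).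
suff -> : row' i (col' ord0 (row_mx B (C *m M)) : 'M_((k + p).+1, _)) =
  row_mx B' (row' (i : 'I_(k + p).+1) C *m M) by exact: IHk.
apply/matrixP=> a b; rewrite !mxE.
case: splitP => b0 /= b0E; case: splitP => b1 /= b1E; rewrite /bump /= in b0E.
- rewrite !mxE; congr (B _ _); apply: val_inj.
  by rewrite /= /bump leq0n -b1E -b0E.
- by have := ltn_ord b0; rewrite -b0E b1E add1n ltnS ltnNge leq_addr.
- by have := ltn_ord b1; rewrite -ltnS -b1E -[X in (X < _)%N]add1n b0E ltnNge leq_addr.
have -> : b0 = b1.
  by apply/val_inj/(@addnI k.+1); rewrite /= -b0E b1E.
by rewrite !mxE; apply: eq_bigr => c _; rewrite !mxE.
Qed.

End Determinants.

(* [row_mx M0 M] is a matrix of relations killed by the column (Z0, Z1), in the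
   way a Fox matrix is killed by the column of the 1 - x_k. *)
Section AugmentedDeterminant.
Context (A : idomainType) (N p q : nat).
Context (M0 : 'M[A]_(q, N)) (M : 'M[A]_(q, p)) (Z0 : 'M[A]_N) (Z1 : 'M[A]_(p, N)).
Context (MZ : row_mx M0 M *m col_mx Z0 Z1 = 0).

(** Right multiplication by [P] replaces the first block of columns by the product with the column
    (Z0, Z1) and keeps the rest; its determinant is that of [Z0]. *)
Let P : 'M[A]_(N + p) := block_mx Z0 0 Z1 1%:M.

Lemma row_mx_mulP m (U : 'M[A]_(m, N + p)) :
  U *m P = row_mx (U *m col_mx Z0 Z1) (rsubmx U).
Proof.
rewrite -[U]hsubmxK /P mul_row_block mul_row_col row_mxKr.
by rewrite mulmx1 mulmx0 add0r.
Qed.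

(** After multiplication by [P] the rows of [C *m row_mx M0 M] begin with a zero block, which makes
    the matrix block upper triangular. *)
Lemma det_augmented (C : 'M[A]_(p, q)) (Y : 'M[A]_(N, N + p)) :
  \det (col_mx Y (C *m row_mx M0 M)) * \det Z0 =
  \det (Y *m col_mx Z0 Z1) * \det (C *m M).
Proof.
have <- : \det P = \det Z0 by rewrite det_lblock det1 mulr1.
rewrite -det_mulmx row_mx_mulP mul_col_mx -mulmxA MZ mulmx0.
rewrite -[rsubmx _]vsubmxK.
have -> : row_mx (col_mx (Y *m col_mx Z0 Z1) 0)
    (col_mx (usubmx (rsubmx (col_mx Y (C *m row_mx M0 M))))
            (dsubmx (rsubmx (col_mx Y (C *m row_mx M0 M))))) =
  block_mx (Y *m col_mx Z0 Z1) (usubmx (rsubmx (col_mx Y (C *m row_mx M0 M)))) 0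
     (dsubmx (rsubmx (col_mx Y (C *m row_mx M0 M)))).
  by rewrite block_mxEh.
rewrite det_ublock; congr (_ * \det _).
by rewrite mul_mx_row -[Y]hsubmxK -block_mxEv block_mxEh row_mxKr col_mxKd.
Qed.

(** Multiplication by [P] kills the first block of the [C] term, so the right side factors through
    [row_mx B (C *m M)], whose determinant is divisible by [d]. *)
Lemma divides_augmented (Y : 'M[A]_(N, N + p)) (C : 'M[A]_(N + p, q))
    (B : 'M[A]_(N + p, N)) u d :
  (forall f : 'I_p -> 'I_q, divides d (\det (rowsub f M))) ->
  u%:M = C *m row_mx M0 M + B *m Y -> divides d (u ^+ (N + p) * \det Z0).
Proof.
move=> dM uE; have detP : \det P = \det Z0 by rewrite det_lblock det1 mulr1.
rewrite -(det_scalar _ u) -detP -det_mulmx uE row_mx_mulP.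
rewrite mulmxDl -!mulmxA MZ mulmx0 add0r.
set X := Y *m _.
have -> : rsubmx (C *m row_mx M0 M + B *m Y) = C *m M + B *m rsubmx Y.
  rewrite mul_mx_row -{1}[Y]hsubmxK mul_mx_row add_row_mx.
  by rewrite row_mxKr.
have -> : row_mx (B *m X) (C *m M + B *m rsubmx Y) =
   row_mx B (C *m M) *m block_mx X (rsubmx Y) 0 1%:M.
  by rewrite mul_row_block mulmx0 addr0 mulmx1 addrC [X in row_mx _ X]addrC.
rewrite det_mulmx mulrC; apply: divides_mull.
exact: divides_det_row_mx.
Qed.

End AugmentedDeterminant.

(** * Fox calculus *)

Lemma multiplicative1 (G H : groupType) (f : {multiplicative G -> H}) : f 1%g = 1%g.
Proof. by apply: (mulgI (f 1%g)); rewrite -gmulfM !mulg1. Qed.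

Section FoxCalculus.
Context (R : idomainType) (P : presentation) (N : nat).
Context (rho : {multiplicative group_of P -> GL R N}).
Context (alpha : {multiplicative group_of P -> Zcyc}).

Local Notation twist := (twist rho alpha).
Local Notation Phi := (Phi rho alpha).

Definition gen_mx (k : 'I_(ngen P)) : 'M[laurent R]_N := twist (fpgen (relators P) k).

Lemma twist1 : twist 1%g = 1%:M.
Proof. by rewrite /Defs.twist !multiplicative1 expr0z scale1r map_mx1. Qed.

Lemma twistM g h : twist (g * h)%g = twist g *m twist h.
Proof.
rewrite /Defs.twist !gmulfM /= map_mxM -scalemxAl -scalemxAr scalerA.
by rewrite exprzDr ?lX_unit.
Qed.

Lemma fproj_fgen k : fproj (fgen k) = fpgen (relators P) k.
Proof. exact: fplift_gen. Qed.

Lemma fproj_fclass w : fproj (fclass w) = wclass (relators P) w.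
Proof.
rewrite /fproj fplift_wclass; elim: w => [|a w IHw].
  by rewrite /weval big_nil wclass_nil.
rewrite -[a :: w]cat1s weval_cat IHw wclass_cat /weval big_cons big_nil mulg1.
by case: a => i [] //=; rewrite /fpgen -wclass_inv.
Qed.

Lemma PhiU g : Phi << g >> = twist (fproj g).
Proof. exact: linextU. Qed.

Lemma Phi_lmulg g x : Phi (lmulg g x) = twist (fproj g) *m Phi x.
Proof.
rewrite /Defs.Phi /lmulg linext_comp !linextE mulmx_sumr; apply: eq_bigr => h _.
by rewrite linextU gmulfM twistM -!scaler_int scalemxAr.
Qed.

Lemma Phi_fox_letter k a : Phi (fox_letter k a) =
  if a.1 == k then
    if a.2 then - twist (fproj (fclass [:: a])) else 1%:M
  else 0.
Proof.
rewrite /fox_letter; case: a => i b /=; case: eqP => _; last exact: linext0.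
case: b; last by rewrite PhiU multiplicative1 twist1.
by rewrite /Defs.Phi linextN linextU -wclass_inv.
Qed.

(** The fundamental formula of Fox calculus, by induction on the word. For a relator the right side
    is 0, which yields M Z = 0. *)
Lemma fox_fundamental w :
  \sum_k Phi (fox_word k w) *m (1%:M - gen_mx k) = 1%:M - twist (wclass (relators P) w).
Proof.
elim: w => [|a w IHw].
  rewrite wclass_nil twist1 subrr big1 // => k _.
  by rewrite /Defs.Phi linext0 mul0mx.
under eq_bigr => k _.
  rewrite /= /Defs.Phi linextD -/Phi Phi_lmulg mulmxDl -mulmxA Phi_fox_letter; over.
rewrite big_split /= -mulmx_sumr IHw -[a :: w]cat1s wclass_cat twistM fproj_fclass.
rewrite mulmxBr mulmx1 addrA; congr (_ - _).
rewrite (bigD1 a.1) //= eqxx big1 => [|k /negPf ka]; last first.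
  by rewrite eq_sym ka mul0mx.
rewrite addr0; case: a => i [] /=; last by rewrite mul1mx subrK.
rewrite mulNmx mulmxBr mulmx1 opprB addrNK /gen_mx -twistM -wclass_cat.
suff -> : wclass (relators P) ([:: (i, true)] ++ [:: (i, false)]) = 1%g by exact: twist1.
by apply/wclassP; apply: (cong_cancel _ (i, true)).
Qed.

Lemma wclass_relator u v : u ++ winv v \in relators P ->
  wclass (relators P) u = wclass (relators P) v.
Proof.
move=> /wclass_rel; rewrite wclass_cat wclass_inv => uv.
by apply: (mulIg (wclass (relators P) v)^-1%g); rewrite uv mulgV.
Qed.

(** The derivative of u v^-1 is du - u v^-1 dv, and u v^-1 is trivial in the group. *)
Lemma Phi_fox_relator k u v : u ++ winv v \in relators P ->
  Phi (fox_word k (u ++ winv v)) = Phi (fox_word k u) - Phi (fox_word k v).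
Proof.
move=> /wclass_relator uv.
(* This is the product rule applied to v^-1 v = 1. *)
have foxV : fox_word k (winv v) = - lmulg (fclass (winv v)) (fox_word k v).
  have := fox_word_cong k (cong_winvl [::] v).
  by rewrite fox_word_cat => /eqP; rewrite addr_eq0 => /eqP.
rewrite fox_word_cat foxV lmulgN /Defs.Phi linextB -/Phi !Phi_lmulg !fproj_fclass.
by rewrite mulmxA -twistM wclass_inv uv mulgV twist1 mul1mx.
Qed.

Lemma Phi_fox_word2 k i j :
  Phi (fox_word k ([:: (i, false)] ++ [:: (j, false)])) =
  (i == k)%:R%:M + (j == k)%:R *: gen_mx i.
Proof.
rewrite /= lmulg0 addr0 /Defs.Phi linextD -/Phi Phi_lmulg !Phi_fox_letter /=.
rewrite fproj_fclass -/(gen_mx i).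
case: eqP => _; case: eqP => _; rewrite ?mulmx1 ?mulmx0 ?scale1r ?scale0r //.
all: by rewrite ?raddf0.
Qed.

Lemma Phi_fox_word3 k i j :
  Phi (fox_word k ([:: (i, false)] ++ [:: (j, false)] ++ [:: (i, false)])) =
  (i == k)%:R *: (1%:M + gen_mx i *m gen_mx j) + (j == k)%:R *: gen_mx i.
Proof.
rewrite catA fox_word_cat /Defs.Phi linextD -/Phi Phi_fox_word2 Phi_lmulg /=.
rewrite lmulg0 addr0 Phi_fox_letter fproj_fclass -[[:: _; _]]cat1s wclass_cat twistM.
rewrite -/(gen_mx i) -/(gen_mx j) addrAC; congr (_ + _).
by case: eqP => _; rewrite /= ?mulmx1 ?scale1r // mulmx0 addr0 scale0r raddf0.
Qed.

Lemma Phi_fox_comm k i j :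
  ([:: (i, false)] ++ [:: (j, false)]) ++
    winv ([:: (j, false)] ++ [:: (i, false)]) \in relators P ->
  Phi (fox_word k (([:: (i, false)] ++ [:: (j, false)]) ++
    winv ([:: (j, false)] ++ [:: (i, false)]))) =
  (i == k)%:R *: (1%:M - gen_mx j) + (j == k)%:R *: - (1%:M - gen_mx i).
Proof.
move=> ijP; rewrite Phi_fox_relator // !Phi_fox_word2.
move: (gen_mx i) (gen_mx j) (i == k) (j == k) => X Y b c.
by rewrite -![_%:R%:M]scalemx1; apply/matrixP=> x y; rewrite !mxE; ring.
Qed.

Lemma Phi_fox_braid k i j :
  ([:: (i, false)] ++ [:: (j, false)] ++ [:: (i, false)]) ++
    winv ([:: (j, false)] ++ [:: (i, false)] ++ [:: (j, false)]) \in relators P ->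
  Phi (fox_word k (([:: (i, false)] ++ [:: (j, false)] ++ [:: (i, false)]) ++
    winv ([:: (j, false)] ++ [:: (i, false)] ++ [:: (j, false)]))) =
  (i == k)%:R *: (1%:M - gen_mx j + gen_mx i *m gen_mx j) +
  (j == k)%:R *: - (1%:M - gen_mx i + gen_mx j *m gen_mx i).
Proof.
move=> ijP; rewrite Phi_fox_relator // !Phi_fox_word3.
move: (gen_mx i *m gen_mx j) (gen_mx j *m gen_mx i) => XY YX.
move: (gen_mx i) (gen_mx j) (i == k) (j == k) => X Y b c.
by apply/matrixP=> x y; rewrite !mxE; ring.
Qed.

Lemma wada_denomE j : wada_denom rho alpha j = \det (1%:M - gen_mx j).
Proof.
by rewrite /wada_denom /Defs.Phi linextB !linextU fproj_fgen multiplicative1 twist1.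
Qed.

(** The j-th block column is moved to the front, so that the rest is literally [fox_mx]. [block_col]
    and [block_row] follow the same order. *)
Definition fox_mx_full j : 'M[laurent R]_(\sum_(i < nrel P) N, N + \sum_(k < (ngen P).-1) N) :=
  row_mx (\mxcol_(i < nrel P) Phi (fox j (relator i))) (fox_mx rho alpha j).

Definition block_col j (Z : 'I_(ngen P) -> 'M[laurent R]_N) :
    'M[laurent R]_(N + \sum_(k < (ngen P).-1) N, N) :=
  col_mx (Z j) (\mxcol_(k < (ngen P).-1) Z (fintype.lift j k)).

Definition block_row m j (Y : 'I_(ngen P) -> 'M[laurent R]_(m, N)) :
    'M[laurent R]_(m, N + \sum_(k < (ngen P).-1) N) :=
  row_mx (Y j) (\mxrow_(k < (ngen P).-1) Y (fintype.lift j k)).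

Lemma sum_lift (V : zmodType) n (j : 'I_n) (F : 'I_n -> V) :
  F j + \sum_(k < n.-1) F (fintype.lift j k) = \sum_k F k.
Proof. by case: n j F => [[]//|n] j F; rewrite [RHS](bigD1_ord j). Qed.

Lemma mul_block_row_col m j (Y : _ -> 'M_(m, N)) Z :
  block_row j Y *m block_col j Z = \sum_k Y k *m Z k.
Proof. by rewrite mul_row_col mul_mxrow_mxcol (sum_lift j (fun k => Y k *m Z k)). Qed.

Lemma mul_mx_block_row r m j (X : 'M_(r, m)) (Y : _ -> 'M_(m, N)) :
  X *m block_row j Y = block_row j (fun k => X *m Y k).
Proof. by rewrite /block_row mul_mx_row mul_mxrow. Qed.

Lemma block_row_sum (I : finType) m j (Y : I -> _ -> 'M_(m, N)) :
  block_row j (fun k => \sum_i Y i k) = \sum_i block_row j (Y i).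
Proof.
apply/matrixP=> a b; rewrite summxE -[b]splitK.
case: (split b) => b' /=.
  by rewrite row_mxEl summxE; apply: eq_bigr => i _; rewrite row_mxEl.
by rewrite row_mxEr mxE summxE; apply: eq_bigr => i _; rewrite row_mxEr [in RHS]mxE.
Qed.

(** This plays the role of dx_k: [v *m block_unit j k] is the row v placed in block k. *)
Definition block_unit j k := block_row j (fun k' => (k' == k)%:R%:M).

Lemma block_rowE m j (Y : _ -> 'M_(m, N)) :
  block_row j Y = \sum_k Y k *m block_unit j k.
Proof.
transitivity (\sum_k block_row j (fun k' => Y k *m (k' == k)%:R%:M)).
  2: by apply: eq_bigr => k _; rewrite -mul_mx_block_row.
rewrite -block_row_sum; congr block_row; apply: funext => k'.
rewrite (bigD1 k') //= eqxx mulmx1 big1 ?addr0 // => k /negPf kk'.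
by rewrite eq_sym kk' raddf0 mulmx0.
Qed.

Lemma block_rowP m j (v : 'M_(m, _)) : exists Y, v = block_row j Y.
Proof.
exists (fun k => if unlift j k is Some k' then submxrow (rsubmx v) k' else lsubmx v).
rewrite /block_row unlift_none -[LHS]hsubmxK -[X in row_mx _ X]submxrowK.
by congr row_mx; apply: eq_mxrow => k; rewrite liftK.
Qed.

Lemma block_row_delta2 m j a b (X X' : 'M_(m, N)) :
  block_row j (fun k => (a == k)%:R *: X + (b == k)%:R *: X') =
  X *m block_unit j a + X' *m block_unit j b.
Proof.
rewrite !mul_mx_block_row /block_row add_row_mx -mxrowD.
have XE (k c : 'I_(ngen P)) (Z : 'M[laurent R]_(m, N)) : (c == k)%:R *: Z = Z *m (k == c)%:R%:M.
  by rewrite mul_mx_scalar eq_sym.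
by congr row_mx; rewrite ?XE //; apply: eq_mxrow => k; rewrite !XE.
Qed.

Lemma block_unit_col j Z k : block_unit j k *m block_col j Z = Z k.
Proof.
rewrite mul_block_row_col (bigD1 k) //= eqxx mul1mx big1 ?addr0 // => k' /negPf kk'.
by rewrite kk' raddf0 mul0mx.
Qed.

Lemma fox_mx_fullE j : fox_mx_full j =
  \mxcol_(i < nrel P) block_row j (fun k => Phi (fox k (relator i))).
Proof.
rewrite /fox_mx_full /fox_mx mxblockEv; apply/matrixP=> a b.
by rewrite -[b]splitK; case: (split b) => b'; rewrite ?(row_mxEl, row_mxEr, mxE).
Qed.

(** Lets a relator be named by its word instead of its index; [c] carries v in the block of that
    index. *)
Lemma fox_mx_full_row j r (v : 'rV_N) : r \in relators P ->
  exists c, c *m fox_mx_full j = v *m block_row j (fun k => Phi (fox_word k r)).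
Proof.
move=> /(tnthP (in_tuple _))[i ->].
exists (\mxrow_(i' < nrel P) ((i' == i)%:R *: v : 'rV__)).
rewrite fox_mx_fullE mul_mxrow_mxcol (bigD1 i) //= eqxx scale1r.
rewrite [X in _ + X]big1 => [|i' /negPf ->]; last by rewrite scale0r mul0mx.
by rewrite addr0; congr (_ *m block_row _ _); apply: funext => k; rewrite fox_fclass.
Qed.

Lemma fox_mx_full_gen j :
  fox_mx_full j *m block_col j (fun k => 1%:M - gen_mx k) = 0.
Proof.
rewrite fox_mx_fullE mxcol_mul -[RHS]mxcol0; apply: eq_mxcol => i.
rewrite mul_block_row_col; under eq_bigr do rewrite fox_fclass.
rewrite fox_fundamental wclass_rel ?mem_tnth // twist1 subrr //.
Qed.

End FoxCalculus.

(** * Relations between the rows of the Fox matrix of the braid group *)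

Ltac entrywise := apply/rowP => ?; rewrite !mxE; ring.

(* E a i stands for the row e_a * dx_i, where x_i = sigma_(i+1) and e_a is the a-th
   standard row vector: e_i zT_i = z e_(i+1), e_(i+1) zT_i = z t e_i and
   e_a zT_i = z e_a for the other a.  The relations are the rows of the Fox matrix of
   the braid relations, together with the gauge E i i = 0. *)
Section BraidRows.
Context (A : comUnitRingType) (n m : nat) (t z : A) (E : nat -> nat -> 'rV[A]_m).
Context (z_unit : z \is a GRing.unit).

Definition far i j := ((i.+1 < j) || (j.+1 < i))%N.

Record braid_rows (S : 'rV[A]_m -> Prop) := BraidRows {
  br_0 : S 0;
  br_lin : forall a u v, S u -> S v -> S (a *: u + v);
  br_diag : forall i, (i.+1 < n)%N -> S (E i i);
  br_comm0 : forall i j, (i.+1 < n)%N -> (j.+1 < n)%N -> far i j ->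
    S ((1 - z) *: E i i - (E i j - z *: E i.+1 j));
  br_comm1 : forall i j, (i.+1 < n)%N -> (j.+1 < n)%N -> far i j ->
    S ((1 - z) *: E i.+1 i - (E i.+1 j - (z * t) *: E i j));
  br_braid : forall a i, (i.+2 < n)%N -> (a < n)%N -> ((a < i) || (i.+2 < a))%N ->
    S ((1 - z + z ^+ 2) *: (E a i - E a i.+1));
  br_braid0 : forall i, (i.+2 < n)%N ->
    S ((1 - z) *: E i i + z ^+ 2 *: E i.+2 i
       - (E i i.+1 - z *: E i.+1 i.+1 + z ^+ 2 *: E i.+1 i.+1));
  br_braid1 : forall i, (i.+2 < n)%N ->
    S (E i.+1 i - z *: E i.+2 i + (z ^+ 2 * t) *: E i i
       - (E i.+1 i.+1 - (z * t) *: E i i.+1 + z ^+ 2 *: E i.+2 i.+1));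
  br_braid2 : forall i, (i.+2 < n)%N ->
    S (E i.+2 i - (z * t) *: E i.+1 i + (z ^+ 2 * t) *: E i.+1 i
       - ((1 - z) *: E i.+2 i.+1 + (z ^+ 2 * t ^+ 2) *: E i i.+1))
}.

Lemma br_scale S u : braid_rows S -> S u -> forall a, S (a *: u).
Proof. by move=> bS Su a; rewrite -[_ *: _]addr0; apply: br_lin => //; apply: br_0. Qed.

(** The v with u v in S form a module with the same relations, so annihilating factors can be
    collected one at a time. *)
Lemma braid_rows_scale S u : braid_rows S -> braid_rows (fun v => S (u *: v)).
Proof.
move=> bS; split=> [|a v w Sv Sw|*|*|*|*|*|*|*].
- by rewrite scaler0; apply: br_0.
- by rewrite scalerDr scalerA mulrC -scalerA; apply: br_lin.
all: by apply: br_scale => //; case: bS; auto.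
Qed.

Section Consequences.
Context (S : 'rV[A]_m -> Prop) (bS : braid_rows S).

Lemma br_lin2 v a x b y : S x -> S y -> v = a *: x + b *: y -> S v.
Proof. by move=> Sx Sy ->; apply: br_lin => //; apply: br_scale. Qed.

Lemma br_lin3 v a x b y c w : S x -> S y -> S w ->
  v = a *: x + b *: y + c *: w -> S v.
Proof.
by move=> Sx Sy Sw ->; rewrite -addrA; apply: br_lin => //; apply: br_lin2 (erefl _).
Qed.

Lemma br_lin4 v a x b y c w d x' : S x -> S y -> S w -> S x' ->
  v = a *: x + b *: y + c *: w + d *: x' -> S v.
Proof.
move=> Sx Sy Sw Sx' ->; rewrite -!addrA; apply: br_lin => //; rewrite addrA.
exact: br_lin3 (erefl _).
Qed.

Lemma br_unit v : S (z *: v) -> S v.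
Proof.
by move=> Sv; rewrite -[v]scale1r -(mulVr z_unit) -scalerA; apply: br_scale.
Qed.

(** With the gauge E i i = 0, row e_i of the commutation relation reads E i j = z E (i+1) j. *)
Lemma br_shift i j : (i.+1 < n)%N -> (j.+1 < n)%N -> far i j ->
  S (E i j - z *: E i.+1 j).
Proof.
move=> ni nj ij; apply: (br_lin2 (a := 1 - z) (b := -1) (br_diag bS ni) (br_comm0 bS ni nj ij)).
entrywise.
Qed.

Lemma br_left a j : (j.+1 < n)%N -> S (E 0%N j) -> (a < j)%N -> S (E a j).
Proof.
move=> nj S0; elim: a => // a IHa aj; apply: br_unit.
have Sd : S (E a j - z *: E a.+1 j) by apply: br_shift; rewrite /far; lia.
by apply: (br_lin2 (a := 1) (b := -1) (IHa (ltnW aj)) Sd); entrywise.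
Qed.

Lemma br_right a j : S (E j.+2 j) -> (j.+1 < a < n)%N -> S (E a j).
Proof.
move=> Sj; elim: a => // a IHa /andP[ja an].
have [<- //|ja'] := eqVneq j.+1 a; apply: br_unit.
have Sa : S (E a j) by apply: IHa; lia.
have Sd : S (E a j - z *: E a.+1 j) by apply: br_shift; rewrite /far; lia.
by apply: (br_lin2 (a := 1) (b := -1) Sa Sd); entrywise.
Qed.

(** Row e_i of the braid relation, after the gauge has removed E i i and E (i+1) (i+1). *)
Lemma br_link i : (i.+2 < n)%N -> S (z ^+ 2 *: E i.+2 i - E i i.+1).
Proof.
move=> ni; apply: (br_lin3 (a := z - 1) (b := z ^+ 2 - z) (c := 1)
  (br_diag bS (ltnW ni)) (br_diag bS ni) (br_braid0 bS ni)).
entrywise.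
Qed.

Lemma br_right0 i : (i.+2 < n)%N -> S (E i i.+1) -> S (E i.+2 i).
Proof.
move=> ni Si; do 2 apply: br_unit.
by apply: (br_lin2 (a := 1) (b := 1) (br_link ni) Si); entrywise.
Qed.

(** Entries E a i with a < i follow by shifting from row 0, those with a = i are the gauge, and
    those with a > i+1 follow by [br_link] and shifting. Only E (i+1) i remains. *)
Lemma br_all : S (E 1%N 0%N) ->
  (forall j, (0 < j)%N -> (j.+1 < n)%N -> S (E 0%N j)) ->
  forall a i, (a < n)%N -> (i.+1 < n)%N -> S (E a i).
Proof.
move=> S10 S0 a i an ni.
have SL b j : (b < j)%N -> (j.+1 < n)%N -> S (E b j).
  by move=> bj nj; apply: br_left => //; apply: S0 => //; case: j bj {nj}.
have SR j : (j.+2 < n)%N -> S (E j.+2 j) by move=> nj; apply: br_right0 => //; apply: SL.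
have SF : S (E i.+1 i).
  (* Row e_(i+1) of the braid relation expresses z^2 E (i+2) (i+1) by E (i+1) i and entries already
     known. *)
  elim: i ni => // i IHi ni; do 2 apply: br_unit.
  have SX := br_lin3 (a := z ^+ 2 * t) (b := -1) (c := -1)
    (br_diag bS (ltnW ni)) (br_diag bS ni) (br_braid1 bS ni) (erefl _).
  apply: (br_lin4 (a := 1) (b := -z) (c := z * t) (d := 1)
    (IHi (ltnW ni)) (SR _ ni) (SL i i.+1 (leqnn _) ni) SX).
  by entrywise.
have [ai|ia|->] := ltngtP a i; [exact: SL | | exact: br_diag].
have [<- //|ia'] := eqVneq i.+1 a; apply: br_right; last lia.
by apply: SR; lia.
Qed.

End Consequences.

(** Multiplied by z^2 - z + 1, the E 0 j with j >= 1 all agree by the braid relations, hence vanish.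
    The factor z - 1 is for E 1 0, through the commutation of generators 0 and n - 2, which are far
    apart as n >= 4. *)
Lemma br_kill1 S : (3 < n)%N -> braid_rows S -> S (E 0%N n.-2) ->
  forall a i, (a < n)%N -> (i.+1 < n)%N ->
  S (((z - 1) * (z ^+ 2 - z + 1)) *: E a i).
Proof.
move=> n3 bS S0; set p := z ^+ 2 - z + 1.
have bp := braid_rows_scale p bS.
have Sp0 j : (0 < j)%N -> (j.+1 < n)%N -> S (p *: E 0%N j).
  move=> j0 nj; have [k jk] : exists k, (j + k)%N = n.-2 by exists (n.-2 - j)%N; lia.
  elim: k j jk j0 nj => [|k IHk] j jk j0 nj.
    by move: jk; rewrite addn0 => ->; apply: br_scale.
  have Sj : S (p *: E 0%N j.+1) by apply: IHk; lia.
  have Sd := @br_braid _ bS 0%N j _ _ _.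
  apply: (br_lin2 bS (a := 1) (b := 1) Sj (Sd _ _ _)); try lia.
  by rewrite /p; entrywise.
have n2 : (n.-2.+1 < n)%N by lia.
have Sp1 : S (p *: E 1%N n.-2).
  by apply: (br_left bp) => //; [apply: Sp0; lia | lia].
apply: (br_all (braid_rows_scale _ bS)).
  have far0 : far 0%N n.-2 by rewrite /far; lia.
  have n1 : (1 < n)%N by lia.
  apply: (br_lin3 bS (a := - p) (b := -1) (c := z * t * p)
     (br_comm1 bS n1 n2 far0) Sp1 S0).
  by rewrite /p; entrywise.
by move=> j j0 nj; rewrite -scalerA; apply: br_scale => //; apply: Sp0.
Qed.

(** For j >= 2, commutation with generator 0 gives E 0 j = z E 1 j and E 1 j = z t E 0 j, so 1 - t
    z^2 kills E 0 j. The case j = 1 brings in the factor 1 + t z^3. *)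
Lemma br_kill2 S : (3 < n)%N -> braid_rows S -> S (E 0%N 0%N + z *: E 1%N 0%N) ->
  forall a i, (a < n)%N -> (i.+1 < n)%N ->
  S (((1 - t * z ^+ 2) * (1 + t * z ^+ 3)) *: E a i).
Proof.
move=> n3 bS S0; set u := 1 - t * z ^+ 2.
have n1 : (1 < n)%N by lia.
have n2 : (2 < n)%N by lia.
have S00 := br_diag bS n1.
have S11 := br_diag bS n2.
have S10 : S (E 1%N 0%N).
  by apply: (br_unit bS); apply: (br_lin2 bS (a := 1) (b := -1) S0 S00); entrywise.
apply: (br_all (braid_rows_scale _ bS)) => [|[//|j] _ nj]; first exact: br_scale.
case: j nj => [|j] nj.
  (* Row e_1 of the braid relation gives z E 2 1 = - u E 2 0, and [br_link] gives E 0 1 = z^2 E 2 0;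
     substituted into z^2 times row e_2, they leave z u (1 + t z^3) E 2 0. *)
  have SR : S ((u * (1 + t * z ^+ 3)) *: E 2%N 0%N).
    have SL := br_link bS n2.
    have S21 : S (z ^+ 2 *: E 2%N 1%N + (z * u) *: E 2%N 0%N).
      have SX := br_lin2 bS (a := -1) (b := - (z * t)) (br_braid1 bS n2) SL (erefl _).
      apply: (br_lin4 bS (a := 1) (b := z ^+ 2 * t) (c := -1) (d := 1) S10 S00 S11 SX).
      by rewrite /u; entrywise.
    apply: (br_unit bS); apply: (br_lin4 bS (a := z ^+ 2) (b := 1 - z)
      (c := - (z ^+ 4 * t ^+ 2)) (d := z ^+ 2 * (z * t - z ^+ 2 * t))
      (br_braid2 bS n2) S21 SL S10).
    by rewrite /u; entrywise.
  apply: (br_lin2 bS (a := - (u * (1 + t * z ^+ 3))) (b := z ^+ 2) (br_link bS n2) SR).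
  by entrywise.
have far0 : far 0%N j.+2 by [].
rewrite mulrC -scalerA; apply: br_scale => //.
apply: (br_lin3 bS (a := 1) (b := - z) (c := z * (1 - z))
  (br_shift bS n1 nj far0) (br_comm1 bS n1 nj far0) S10).
by rewrite /u; entrywise.
Qed.

End BraidRows.

Lemma braid_rows_of_action (A : comUnitRingType) (n N m : nat) (t z : A)
    (e : nat -> 'rV[A]_N) (G : nat -> 'M[A]_N) (D : nat -> 'M[A]_(N, m))
    (S : 'rV[A]_m -> Prop) :
  (forall i, (i.+1 < n)%N -> e i *m G i = z *: e i.+1) ->
  (forall i, (i.+1 < n)%N -> e i.+1 *m G i = (z * t) *: e i) ->
  (forall a i, (i.+1 < n)%N -> (a < n)%N -> a != i -> a != i.+1 ->
     e a *m G i = z *: e a) ->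
  S 0 -> (forall a u v, S u -> S v -> S (a *: u + v)) ->
  (forall i, (i.+1 < n)%N -> S (e i *m D i)) ->
  (forall v i j, (i.+1 < n)%N -> (j.+1 < n)%N -> far i j ->
     S (v *m (1%:M - G j) *m D i - v *m (1%:M - G i) *m D j)) ->
  (forall v i, (i.+2 < n)%N ->
     S (v *m (1%:M - G i.+1 + G i *m G i.+1) *m D i -
        v *m (1%:M - G i + G i.+1 *m G i) *m D i.+1)) ->
  braid_rows n t z (fun a k => e a *m D k) S.
Proof.
move=> e0 e1 eid S0 Slin Sdiag Scomm Sbraid.
have expand (v : 'rV[A]_N) (X Y Z : 'M[A]_N) :
    v *m (1%:M - X + Y *m Z) = v - v *m X + v *m Y *m Z.
  by rewrite mulmxDr mulmxBr mulmx1 mulmxA.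
split=> // [i j ni nj ij|i j ni nj ij|a i ni na ai|i ni|i ni|i ni].
- have := Scomm (e i) i j ni nj ij.
  rewrite !mulmxBr !mulmx1 e0 // eid //; try (move: ij; rewrite /far; lia).
  rewrite !mulmxBl -!scalemxAl.
  move: (e i *m D i) (e i *m D j) (e i.+1 *m D j) => x y w.
  by congr S; entrywise.
- have := Scomm (e i.+1) i j ni nj ij.
  rewrite !mulmxBr !mulmx1 e1 // eid //; try (move: ij; rewrite /far; lia).
  rewrite !mulmxBl -!scalemxAl.
  move: (e i.+1 *m D i) (e i *m D j) (e i.+1 *m D j) => x y w.
  by congr S; entrywise.
- have := Sbraid (e a) i ni; rewrite !expand !eid; try lia.
  rewrite -!scalemxAl !eid; try lia.
  rewrite !(mulmxDl, mulNmx) -!scalemxAl; move: (e a *m D i) (e a *m D i.+1) => x y.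
  by congr S; entrywise.
- have := Sbraid (e i) i ni; rewrite !expand e0; last lia.
  rewrite [e i *m G i.+1]eid; try lia.
  rewrite -!scalemxAl !e0; try lia.
  rewrite !(mulmxDl, mulNmx) -!scalemxAl.
  move: (e i *m D i) (e i.+2 *m D i) (e i *m D i.+1) (e i.+1 *m D i.+1) => x y w x'.
  by congr S; entrywise.
- have := Sbraid (e i.+1) i ni; rewrite !expand [e i.+1 *m G i.+1]e0; last lia.
  rewrite [e i.+1 *m G i]e1; last lia.
  rewrite -!scalemxAl !eid; try lia.
  rewrite !(mulmxDl, mulNmx) -!scalemxAl.
  move: (e i.+1 *m D i) (e i.+2 *m D i) (e i *m D i) => x y w.
  move: (e i.+1 *m D i.+1) (e i.+2 *m D i.+1) (e i *m D i.+1) => x' y' w'.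
  by congr S; entrywise.
have := Sbraid (e i.+2) i ni; rewrite !expand [e i.+2 *m G i.+1]e1; last lia.
rewrite [e i.+2 *m G i]eid; try lia.
rewrite -!scalemxAl [e i.+2 *m G i.+1]e1 ?[e i.+1 *m G i]e1; try lia.
rewrite !(mulmxDl, mulNmx) -!scalemxAl.
move: (e i.+2 *m D i) (e i.+1 *m D i) (e i.+2 *m D i.+1) (e i *m D i.+1) => x y w x'.
by congr S; entrywise.
Qed.

(** * The Fox matrix of TYM *)

Section BraidFox.
Context (m : nat).
Local Notation n := m.+3.
Local Notation A := (laurent (laurent int)).
Local Notation t := (lC lX : A).
Local Notation z := (lX : A).
Local Notation B := (braid_presentation n).
Local Notation G := (gen_mx (TYM n) (braid_ab n)).
Local Notation Phi := (Phi (TYM n) (braid_ab n)).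
Context (j : 'I_m.+2).

Local Notation W := (n + \sum_(k < (ngen B).-1) n)%N.
Local Notation M := (fox_mx (TYM n) (braid_ab n) (j : 'I_(ngen B))).
Local Notation Mfull := (fox_mx_full (TYM n) (braid_ab n) (j : 'I_(ngen B))).
Local Notation Zcol := (@block_col (laurent int) B n j (fun k => 1%:M - G k)).

Local Notation dcol k := (@block_unit (laurent int) B n j k).

(** Natural number indices spare ordinal arithmetic for i+1 and i+2; out of range [inord] defaults
    to 0, which the bounds in [braid_rows] exclude. *)
Definition unit_row (a : nat) : 'rV[A]_n := delta_mx 0 (inord a).

Lemma gen_mxE (i : 'I_m.+2) : G i = z *: map_mx lC (@tym_mx n i).
Proof.
by rewrite /gen_mx /twist (braid_ab_gen (n := n)) (TYM_gen (n := n)) expr1z.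
Qed.

Lemma unit_row_gen a i : unit_row a *m G i =
  \row_b (z * lC (@tym_mx n i (inord a) b)).
Proof. by rewrite -rowE gen_mxE; apply/rowP=> b; rewrite !mxE. Qed.

Lemma unit_row_gen0 i : (i.+1 < n)%N -> unit_row i *m G (inord i) = z *: unit_row i.+1.
Proof.
move=> ni; rewrite unit_row_gen; apply/rowP=> b; rewrite !mxE !inordK //; last lia.
by rewrite eqxx rmorph_nat -[b == inord _]val_eqE /= inordK.
Qed.

Lemma unit_row_gen1 i : (i.+1 < n)%N ->
  unit_row i.+1 *m G (inord i) = (z * t) *: unit_row i.
Proof.
move=> ni; rewrite unit_row_gen; apply/rowP=> b; rewrite !mxE !inordK //; [|lia..].
rewrite eqxx gtn_eqF // rmorphMn /= -[b == inord _]val_eqE /= inordK; last lia.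
by rewrite -mulrA mulr_natr.
Qed.

Lemma unit_row_gen_id a i : (i.+1 < n)%N -> (a < n)%N -> a != i -> a != i.+1 ->
  unit_row a *m G (inord i) = z *: unit_row a.
Proof.
move=> ni an /negPf ai /negPf ai1; rewrite unit_row_gen; apply/rowP=> b.
rewrite !mxE !inordK //.
by rewrite ai ai1 rmorph_nat eq_sym.
Qed.

Lemma comm_relator_in (a b : 'I_m.+2) : (a.+1 < b)%N -> @comm_relator n a b \in relators B.
Proof.
move=> ab; rewrite mem_cat; apply/orP; left.
by apply/imageP; exists (a, b).
Qed.

Lemma braid_relator_in (a b : 'I_m.+2) : a.+1 = b -> @braid_relator n a b \in relators B.
Proof.
move=> ab; rewrite mem_cat; apply/orP; right.
by apply/imageP; exists (a, b); rewrite ?inE ?ab.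
Qed.

Lemma block_row_comm (a b : 'I_m.+2) : (a.+1 < b)%N ->
  @block_row (laurent int) B n n j (fun k => Phi (fox_word k (@comm_relator n a b))) =
  (1%:M - G b) *m dcol a - (1%:M - G a) *m dcol b.
Proof.
move=> ab; rewrite -mulNmx -block_row_delta2; congr block_row; apply: funext => k.
exact: (@Phi_fox_comm _ B) (comm_relator_in ab).
Qed.

Lemma block_row_braid (a b : 'I_m.+2) : a.+1 = b ->
  @block_row (laurent int) B n n j (fun k => Phi (fox_word k (@braid_relator n a b))) =
  (1%:M - G b + G a *m G b) *m dcol a - (1%:M - G a + G b *m G a) *m dcol b.
Proof.
move=> ab; rewrite -mulNmx -block_row_delta2; congr block_row; apply: funext => k.
exact: (@Phi_fox_braid _ B) (braid_relator_in ab).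
Qed.

(** * The module spanned by the Fox rows and the gauge rows *)

Definition row_gen (a k : nat) : 'rV[A]_W := unit_row a *m dcol (inord k).

(* The gauge rows E i i = 0, preceded by one more row s. *)
Definition gauge_mx (s : 'rV[A]_W) : 'M[A]_(n, W) :=
  \matrix_(a, b) (if a == 0 then s 0 b else row_gen a.-1 a.-1 0 b).

(** Membership means vanishing in the cokernel of the Fox matrix modulo the gauge rows. *)
Definition in_span (s : 'rV[A]_W) (v : 'rV[A]_W) : Prop :=
  exists c y, v = c *m Mfull + y *m gauge_mx s.

Section Span.
Context (s : 'rV[A]_W).
Local Notation S := (in_span s).

Lemma in_span_lin a u v : S u -> S v -> S (a *: u + v).
Proof.
move=> [c [y ->]] [c' [y' ->]]; exists (a *: c + c'), (a *: y + y').
by rewrite !mulmxDl -!scalemxAl scalerDr addrACA.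
Qed.

Lemma in_span0 : S 0.
Proof. by exists 0, 0; rewrite !mul0mx addr0. Qed.

Lemma in_span_scale a v : S v -> S (a *: v).
Proof. by move=> Sv; rewrite -[_ *: _]addr0; apply: in_span_lin => //; apply: in_span0. Qed.

Lemma in_span_gauge (a : 'I_n) : S (row a (gauge_mx s)).
Proof. by exists 0, (delta_mx 0 a); rewrite mul0mx add0r -rowE. Qed.

Lemma in_span_first : S s.
Proof. by have := in_span_gauge 0; congr S; apply/rowP=> b; rewrite !mxE. Qed.

Lemma in_span_diag i : (i.+1 < n)%N -> S (row_gen i i).
Proof.
move=> ni; have := in_span_gauge (inord i.+1); congr S; apply/rowP=> b.
rewrite mxE [LHS]mxE -val_eqE /= inordK //.
Qed.

Lemma in_span_relator v r : r \in relators B ->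
  S (v *m @block_row (laurent int) B n n j (fun k => Phi (fox_word k r))).
Proof.
move=> /(fox_mx_full_row (TYM n) (braid_ab n) j v)[c <-].
by exists c, 0; rewrite mul0mx addr0.
Qed.

Lemma in_span_comm v (a b : 'I_m.+2) : far a b ->
  S (v *m (1%:M - G b) *m dcol a - v *m (1%:M - G a) *m dcol b).
Proof.
wlog ab : a b / (a.+1 < b)%N => [wlog_ab fab|_].
  have [ab|ba] := orP fab; first exact: wlog_ab.
  have /(in_span_scale (-1)) : S (v *m (1%:M - G a) *m dcol b - v *m (1%:M - G b) *m dcol a).
    by apply: wlog_ab; rewrite // /far ba.
  by rewrite scaleN1r opprB.
have := in_span_relator v (comm_relator_in ab).
by rewrite block_row_comm // mulmxBr !mulmxA.
Qed.

Lemma in_span_braid v (a b : 'I_m.+2) : a.+1 = b ->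
  S (v *m (1%:M - G b + G a *m G b) *m dcol a - v *m (1%:M - G a + G b *m G a) *m dcol b).
Proof.
move=> ab; have := in_span_relator v (braid_relator_in ab).
by rewrite block_row_braid // mulmxBr !mulmxA.
Qed.

Lemma braid_rows_in_span : braid_rows n t z row_gen S.
Proof.
have inordK2 i : (i.+1 < n)%N -> (inord i : 'I_m.+2) = i :> nat by move=> ni; rewrite inordK.
apply: (@braid_rows_of_action _ n n W t z unit_row
  (fun i => G (inord i)) (fun k => dcol (inord k))).
- exact: unit_row_gen0.
- exact: unit_row_gen1.
- exact: unit_row_gen_id.
- exact: in_span0.
- exact: in_span_lin.
- exact: in_span_diag.
- by move=> v i k ni nk ik; apply: in_span_comm; rewrite !inordK2.
by move=> v i ni; apply: in_span_braid; rewrite !inordK2 //; apply: ltnW.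
Qed.

Lemma in_span_sum (I : finType) (F : I -> 'rV[A]_W) : (forall i, S (F i)) -> S (\sum_i F i).
Proof.
move=> SF; elim/big_ind: _ => [|x y Sx Sy|//]; first exact: in_span0.
by rewrite -[x]scale1r; apply: in_span_lin.
Qed.

(** The [row_gen a k] in range form a basis of the rows, so killing them by [u] gives the matrix
    equation that [divides_augmented] takes as hypothesis. *)
Lemma in_span_all u :
  (forall a k, (a < n)%N -> (k.+1 < n)%N -> S (u *: row_gen a k)) ->
  exists C Y, u%:M = C *m Mfull + Y *m gauge_mx s.
Proof.
move=> Su; suff /fin_all_exists[c /fin_all_exists[y cyE]] : forall i : 'I_W,
    exists c y, row i u%:M = c *m Mfull + y *m gauge_mx s.
  exists (\matrix_i c i), (\matrix_i y i); apply/row_matrixP=> i.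
  by rewrite cyE linearD /= !row_mul !rowK.
move=> i; suff : S (u *: delta_mx 0 i) by rewrite -scalemx1 linearZ /= row1.
have [Y ->] := @block_rowP (laurent int) B n 1 j (delta_mx 0 i).
rewrite block_rowE scaler_sumr; apply: (in_span_sum (I := 'I_m.+2)) => k.
rewrite [Y k]row_sum_delta mulmx_suml scaler_sumr; apply: (in_span_sum (I := 'I_n)) => a.
rewrite -scalemxAl scalerA mulrC -scalerA; apply: in_span_scale.
have := Su a k (ltn_ord a) (ltn_ord k).
by rewrite /row_gen /unit_row !inord_val.
Qed.

End Span.


Lemma row_gen_col a k : row_gen a k *m Zcol = unit_row a - unit_row a *m G (inord k).
Proof.
have dcolZ : dcol (inord k) *m Zcol = 1%:M - G (inord k) by exact: block_unit_col.
by rewrite /row_gen -mulmxA dcolZ mulmxBr mulmx1.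
Qed.

(** Row 0 of the product is c e_0 and row a > 0 is e_(a-1) - z e_a, so it is lower triangular with
    diagonal c, -z, ..., -z. *)
Lemma det_gauge s c : s *m Zcol = c *: unit_row 0 ->
  \det (gauge_mx s *m Zcol) = c * (- z) ^+ m.+2.
Proof.
move=> sZ.
have XE (a b : 'I_n) : (gauge_mx s *m Zcol) a b =
    if a == 0 then c * (b == 0)%:R else (b == a.-1 :> nat)%:R - z * (b == a)%:R.
  have -> : (gauge_mx s *m Zcol) a b = (row a (gauge_mx s) *m Zcol) 0 b.
    by rewrite -row_mul [RHS]mxE.
  have -> : row a (gauge_mx s) = if a == 0 then s else row_gen a.-1 a.-1.
    by apply/rowP=> b'; rewrite mxE [LHS]mxE; case: ifP.
  case: eqP => [_|/eqP a0].
    by rewrite sZ !mxE -[b == inord 0]val_eqE /= inordK.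
  have {a0} : (0 < a)%N by rewrite lt0n; apply: contra a0 => /eqP a0; apply/eqP/val_inj.
  have := ltn_ord a; rewrite -[b == a]val_eqE /=; case: (a : nat) => // i ni _ /=.
  rewrite row_gen_col unit_row_gen0 // !mxE.
  rewrite -[b == inord i]val_eqE -[b == inord i.+1]val_eqE /= !inordK //.
  exact: ltnW.
rewrite det_trig.
  rewrite big_ord_recl XE !eqxx mulr1; congr (_ * _).
  rewrite (eq_bigr (fun=> - z)) ?prodr_const ?card_ord // => i _.
  by rewrite XE /= eqxx /bump /= add1n (gtn_eqF (ltnSn _)) sub0r mulr1.
apply/is_trig_mxP => a b ab; rewrite XE -[b == 0]val_eqE -[b == a]val_eqE /=.
rewrite (gtn_eqF (leq_ltn_trans (leq0n _) ab)) (gtn_eqF ab) !mulr0 subr0.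
by rewrite gtn_eqF ?if_same //; apply: leq_ltn_trans (leq_pred _) ab.
Qed.

Local Notation D := (wada_denom (TYM n) (braid_ab n) (j : 'I_(ngen B))).

(** [det_augmented] with [C] selecting the rows of [f] and with the gauge rows as [Y]; the power of
    -z from [det_gauge] is a unit. *)
Lemma wada_denom_dvd s c (f : 'I_(\sum_(k < (ngen B).-1) n) -> 'I_(\sum_(i < nrel B) n)) :
  s *m Zcol = c *: unit_row 0 -> divides D (c * \det (rowsub f M)).
Proof.
move=> /det_gauge dY.
have := det_augmented (fox_mx_full_gen (TYM n) (braid_ab n) j) (rowsub f 1%:M) (gauge_mx s).
rewrite -wada_denomE dY !mul_rowsub_mx !mul1mx => detE.
exists (\det (col_mx (gauge_mx s) (rowsub f Mfull)) / (- z) ^+ m.+2).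
have zu : (- z) ^+ m.+2 \is a GRing.unit by rewrite unitrX // unitrN lX_unit.
by apply: (mulIr zu); rewrite [RHS]mulrAC divrK // detE; ring.
Qed.

Lemma wada_denom_kill s u d :
  (forall f : 'I_(\sum_(k < (ngen B).-1) n) -> 'I_(\sum_(i < nrel B) n),
     divides d (\det (rowsub f M))) ->
  (forall a k, (a < n)%N -> (k.+1 < n)%N -> in_span s (u *: row_gen a k)) ->
  divides d (u ^+ W * D).
Proof.
move=> dM /in_span_all[C [Y uE]]; rewrite wada_denomE.
exact: (divides_augmented (fox_mx_full_gen (TYM n) (braid_ab n) j) dM uE).
Qed.

(** The last generator acts on e_0 as z, whence the value (1 - z) e_0. *)
Definition gauge1 : 'rV[A]_W := row_gen 0 m.+1.
(** This is e_0 (1 + G_0) dx_0, with 1 + x_0 the Fox derivative of x_0^2: its value is e_0 (1 -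
    G_0^2), and G_0^2 scales e_0 by t z^2. *)
Definition gauge2 : 'rV[A]_W := row_gen 0 0 + z *: row_gen 1 0.

Lemma gauge1_col : gauge1 *m Zcol = (1 - z) *: unit_row 0.
Proof.
by rewrite /gauge1 row_gen_col unit_row_gen_id // scalerBl scale1r.
Qed.

Lemma gauge2_col : gauge2 *m Zcol = (1 - t * z ^+ 2) *: unit_row 0.
Proof.
rewrite /gauge2 mulmxDl -scalemxAl !row_gen_col unit_row_gen0 // unit_row_gen1 //.
move: (unit_row 0) (unit_row 1) => x y.
by apply/rowP=> i; rewrite !mxE; ring.
Qed.

End BraidFox.

(** * Coprimality of the annihilators *)

(** The determinant is a polynomial in z with value 1 at z = 0. *)
Lemma det_one_sub_lX_neq0 (R : idomainType) N (T : 'M[R]_N) :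
  \det (1%:M - lX *: map_mx lC T) != 0 :> laurent R.
Proof.
pose Q : 'M[{poly R}]_N := 1%:M - 'X *: map_mx polyC T.
have -> : 1%:M - lX *: map_mx lC T = map_mx (@lpoly R) Q.
  apply/matrixP=> a b; rewrite !mxE rmorphB rmorphM /= -/lX; congr (_ - _).
  by rewrite rmorphMn /= rmorph1.
rewrite det_map_mx lpoly_eq0; apply/eqP=> /(congr1 (horner_eval 0)).
rewrite -det_map_mx rmorph0.
have -> : map_mx (horner_eval 0) Q = 1%:M.
  apply/matrixP=> a b; rewrite !mxE /horner_eval !hornerE /= ?mul0r ?subr0.
  by case: (a == b); rewrite ?hornerE.
by rewrite det1 => /eqP; rewrite oner_eq0.
Qed.

Section Regularity.
Local Notation A := (laurent (laurent int)).
Local Notation s := (lX : laurent int).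
Local Notation t := (lC lX : A).
Local Notation z := (lX : A).

Lemma laurent_const_neq0 (R : idomainType) (p : {poly R}) : p.[0] = 1 -> lpoly p != 0.
Proof.
move=> p0; rewrite lpoly_eq0; apply: contra_eq_neq p0 => ->.
by rewrite horner0 eq_sym oner_neq0.
Qed.

Lemma one_sub_s_neq0 : 1 - s != 0.
Proof.
have -> : 1 - s = lpoly (1 - 'X) by rewrite rmorphB rmorph1.
by apply: laurent_const_neq0; rewrite !hornerE ?expr0n ?subr0 ?addr0 ?add0r.
Qed.

Lemma one_add_s_neq0 : 1 + s != 0.
Proof.
have -> : 1 + s = lpoly (1 + 'X) by rewrite rmorphD rmorph1.
by apply: laurent_const_neq0; rewrite !hornerE ?expr0n ?subr0 ?addr0 ?add0r.
Qed.

Lemma one_add_s_add_s2_neq0 : 1 + s + s ^+ 2 != 0.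
Proof.
have -> : 1 + s + s ^+ 2 = lpoly (1 + 'X + 'X^2) by rewrite !rmorphD rmorph1 rmorphXn.
by apply: laurent_const_neq0; rewrite !hornerE ?expr0n ?subr0 ?addr0 ?add0r.
Qed.

Lemma regular_z1 c : c != 0 -> regular_mod (z - 1) (lC c).
Proof.
have -> : z - 1 = lpoly ('X - 1%:P) by rewrite rmorphB rmorph1.
by apply: regular_monic; apply: monicXsubC.
Qed.

Lemma regular_z2 c : c != 0 -> regular_mod (z ^+ 2 - z + 1) (lC c).
Proof.
have -> : z ^+ 2 - z + 1 = lpoly ('X^2 - 'X + 1) by rewrite rmorphD rmorphB rmorph1 rmorphXn.
apply: regular_monic; rewrite -addrA monicE lead_coefDl ?lead_coefXn //.
by rewrite size_polyXn (leq_ltn_trans (size_polyD _ _)) // size_polyN size_polyX size_poly1.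
Qed.

Lemma z1_neq0 : z - 1 != 0.
Proof.
have -> : z - 1 = lpoly ('X - 1%:P) by rewrite rmorphB rmorph1.
by rewrite lpoly_eq0 polyXsubC_eq0.
Qed.

Lemma z2_neq0 : z ^+ 2 - z + 1 != 0.
Proof.
have -> : z ^+ 2 - z + 1 = lpoly ('X^2 - 'X + 1) by rewrite rmorphD rmorphB rmorph1 rmorphXn.
by apply: laurent_const_neq0; rewrite !hornerE ?expr0n ?subr0 ?addr0 ?add0r.
Qed.

Lemma regular_z1_w : regular_mod (z - 1) (1 - t * z ^+ 2).
Proof.
apply: (@regular_bezout _ _ _ (lC (1 - s)) (t * (z + 1)) 1).
  by rewrite rmorphB rmorph1 /=; ring.
exact/regular_z1/one_sub_s_neq0.
Qed.

(** Checked on each pair of factors. The resulting nonzero constants are 1 - t and 1 + t modulo z -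
    1, and 1 + t + t^2 and 1 - t modulo z^2 - z + 1, where z^3 = -1. *)
Lemma regular_kill :
  regular_mod ((z - 1) * (z ^+ 2 - z + 1)) ((1 - t * z ^+ 2) * (1 + t * z ^+ 3)).
Proof.
apply: regular_Mmod; first exact: z1_neq0.
  apply: regular_modM; first exact: regular_z1_w.
  apply: (@regular_bezout _ _ _ (lC (1 + s)) (- t * (z ^+ 2 + z + 1)) 1).
    by rewrite rmorphD rmorph1 /=; ring.
  exact/regular_z1/one_add_s_neq0.
apply: regular_modM.
  (* The resultant in z of the two factors is 1 + t + t^2. *)
  apply: (@regular_bezout _ _ _ (lC (1 + s + s ^+ 2))
    (t ^+ 2 + t * (1 + t * z)) (1 + t * z)).
    rewrite !rmorphD rmorph1 rmorphXn /=; ring.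
  exact/regular_z2/one_add_s_add_s2_neq0.
apply: (@regular_bezout _ _ _ (lC (1 - s)) (- t * (z + 1)) 1).
  by rewrite rmorphB rmorph1 /=; ring.
exact/regular_z2/one_sub_s_neq0.
Qed.

End Regularity.

(** * At least four strands *)

Section LargeBraid.
Context (m : nat) (m_gt0 : (0 < m)%N) (j : 'I_m.+2).
Local Notation n := m.+3.
Local Notation A := (laurent (laurent int)).
Local Notation t := (lC lX : A).
Local Notation z := (lX : A).
Local Notation B := (braid_presentation n).
Local Notation M := (fox_mx (TYM n) (braid_ab n) (j : 'I_(ngen B))).
Local Notation D := (wada_denom (TYM n) (braid_ab n) (j : 'I_(ngen B))).

Lemma is_gcd_wada_denom : is_gcd (is_minor (TYM n) (braid_ab n) (j : 'I_(ngen B))) D.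
Proof.
have n_gt3 : (3 < n)%N by [].
have D0 : D != 0 by rewrite wada_denomE gen_mxE det_one_sub_lX_neq0.
split=> [x [f [_ ->]]|d dM].
  (* Both 1 - z and 1 - t z^2 times the minor are multiples of the denominator. *)
  apply: (divides_coprime z1_neq0 D0 regular_z1_w).
    rewrite -[z - 1]opprB -mulN1r -mulrA; apply: divides_mull.
    exact: (wada_denom_dvd f (gauge1_col j)).
  exact: (wada_denom_dvd f (gauge2_col j)).
have dM' := @divides_det_rowsub _ _ _ M d (fun f f_incr => dM _ (ex_intro _ f (conj f_incr erefl))).
have d1 := wada_denom_kill dM' (br_kill1 (lX_unit _) n_gt3
  (@braid_rows_in_span m j (gauge1 j)) (@in_span_first m j (gauge1 j))).
have d2 := wada_denom_kill dM' (br_kill2 (lX_unit _) n_gt3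
  (@braid_rows_in_span m j (gauge2 j)) (@in_span_first m j (gauge2 j))).
move: d1 d2; move: (n + _)%N D D0 => k D' D0 d1 d2.
have u0 : (z - 1) * (z ^+ 2 - z + 1) != 0 by apply: mulf_neq0; [exact: z1_neq0 | exact: z2_neq0].
have uk0 := expf_neq0 k u0.
(* [d] divides a nonzero element; [divides_coprime] cancels [d], so this is required. *)
have d0 : d != 0.
  apply/eqP=> d0; move: d1 => [q /eqP]; rewrite d0 mulr0 mulf_eq0.
  by rewrite (negPf D0) (negPf uk0).
have r := regular_modX (k := k) (m := k) u0 regular_kill.
apply: (divides_coprime uk0 d0 r d1 d2).
Qed.

End LargeBraid.

(** * Three strands *)

Lemma det_mx33 (R : comNzRingType) (F : nat -> nat -> R) :
  \det (\matrix_(a < 3, b < 3) F a b) =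
    F 0%N 0%N * (F 1%N 1%N * F 2%N 2%N - F 1%N 2%N * F 2%N 1%N)
  - F 0%N 1%N * (F 1%N 0%N * F 2%N 2%N - F 1%N 2%N * F 2%N 0%N)
  + F 0%N 2%N * (F 1%N 0%N * F 2%N 1%N - F 1%N 1%N * F 2%N 0%N).
Proof.
have det2 (H : nat -> nat -> R) :
    \det (\matrix_(a < 2, b < 2) H a b) = H 0%N 0%N * H 1%N 1%N - H 0%N 1%N * H 1%N 0%N.
  rewrite (expand_det_row _ 0) !big_ord_recl big_ord0 /cofactor !det_mx11 !mxE /=.
  rewrite /bump /=; ring.
have minorE (b : 'I_3) : row' 0 (col' b (\matrix_(a < 3, b < 3) F a b)) =
    \matrix_(a < 2, c < 2) F a.+1 (bump b c) :> 'M_2.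
  by apply/matrixP=> a c; rewrite !mxE /=.
rewrite (expand_det_row _ 0) !big_ord_recl big_ord0 /cofactor !minorE.
rewrite !(det2 (fun a c => F a.+1 (bump _ c))) !mxE /= /bump /=.
by ring.
Qed.

(** The two generators are adjacent, so there is no commutation relator and a single braid
    relator. *)
Lemma nrel3 : nrel (braid_presentation 3) = 1%N.
Proof.
rewrite /nrel size_cat !size_image eq_card0 => [|[[a a2] [b b2]]]; last first.
  by rewrite !inE /=; lia.
rewrite (@eq_card1 _ ((0 : 'I_2), (1 : 'I_2))) // => -[[a a2] [b b2]].
by case: a a2 => [|[|a]] // ?; case: b b2 => [|[|b]].
Qed.

Lemma sig2_single q N (s : 'I_(\sum_(i < q) N)) : q = 1%N -> tagnat.sig2 s = s :> nat.
Proof.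
move=> q1; subst q; rewrite [RHS]tagnat.rect big_pred0 // => i.
by rewrite [tagnat.sig1 s]ord1.
Qed.

(** Strict growth gives a <= f a counting up from 0, and f a <= a counting down from n - 1. *)
Lemma increasing_ord_id n (f : 'I_n -> 'I_n) :
  {homo f : a b / (a < b)%N} -> forall a, f a = a :> nat.
Proof.
move=> f_incr a.
have ge k : forall b : 'I_n, b = k :> nat -> (k <= f b)%N.
  elim: k => // k IHk b bk; have nk : (k < n)%N by rewrite ltnW // -bk.
  by apply: leq_ltn_trans (IHk (Ordinal nk) erefl) _; apply: f_incr; rewrite /= bk.
have le k : forall b : 'I_n, (b + k.+1 = n)%N -> (f b + k.+1 <= n)%N.
  elim: k => [|k IHk] b bk; first by rewrite addn1.
  have nk : (b.+1 < n)%N by lia.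
  have := IHk (Ordinal nk); rewrite /= addSn -addnS => /(_ bk).
  by apply: leq_trans; rewrite addnS -addSn leq_add2r; apply: f_incr.
apply/eqP; rewrite eqn_leq (ge _ a erefl) // andbT.
have := le (n - a).-1 a; have := ltn_ord a; lia.
Qed.

Section ThreeStrands.
Local Notation A := (laurent (laurent int)).
Local Notation t := (lC lX : A).
Local Notation z := (lX : A).
Local Notation B := (braid_presentation 3).
Local Notation G := (gen_mx (TYM 3) (braid_ab 3)).
Local Notation Phi := (Phi (TYM 3) (braid_ab 3)).

(** With one relator and one remaining generator the matrix is a single 3 x 3 block, and the only
    increasing choice of its rows is the identity. *)
Lemma three_strand_minor (j : 'I_2) x :
  is_minor (TYM 3) (braid_ab 3) (j : 'I_(ngen B)) x <->
  x = \det (Phi (fox_word (fintype.lift j ord0 : 'I_(ngen B)) (@braid_relator 3 0 1))).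
Proof.
set X := Phi _.
have p3 : (\sum_(k < (ngen B).-1) 3 = 3)%N by rewrite sum_nat_const card_ord.
have q3 : (\sum_(i < nrel B) 3 = 3)%N by rewrite sum_nat_const card_ord nrel3.
(* The index types are sums of block sizes, equal to 3 by a proof, so entries are compared through
   casts. *)
have det_cast p (e : p = 3%N) (Y : 'M[A]_p) :
    (forall a b, Y a b = X (cast_ord e a) (cast_ord e b)) -> \det Y = \det X.
  by move=> YE; subst p; congr (\det _); apply/matrixP=> a b; rewrite YE !cast_ord_id.
have rel_i (i : 'I_(nrel B)) : tnth (in_tuple (relators B)) i = @braid_relator 3 0 1.
  have /(tnthP (in_tuple _))[i' ->] := @braid_relator_in 0 0 1 erefl.
  have lt1 k : (k < nrel B)%N -> k = 0%N by rewrite nrel3; case: k.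
  by congr tnth; apply: val_inj; rewrite /= (lt1 _ (ltn_ord i)) (lt1 _ (ltn_ord i')).
have minorE (f : 'I_(\sum_(k < (ngen B).-1) 3) -> 'I_(\sum_(i < nrel B) 3)) :
    (forall a, f a = a :> nat) ->
    \det (rowsub f (fox_mx (TYM 3) (braid_ab 3) (j : 'I_(ngen B)))) = \det X.
  move=> fE; apply: (det_cast _ p3) => a b.
  rewrite [LHS]mxE [LHS]mxE /relator fox_fclass rel_i [tagnat.sig1 b]ord1.
  congr (X _ _); apply: val_inj => /=; rewrite sig2_single ?nrel3 //.
split=> [[f [f_incr ->]]|->]; last first.
  pose f a := cast_ord (etrans p3 (esym q3)) a.
  by exists f; split=> [a b|] //; rewrite minorE.
apply: minorE; move: f f_incr; move: (etrans q3 (esym p3)).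
move: (\sum_(i < nrel B) 3)%N => q qE; subst q => f f_incr.
apply: increasing_ord_id f_incr.
Qed.
End ThreeStrands.

Section ThreeStrandDeterminant.
Local Notation A := (laurent (laurent int)).
Local Notation t := (lC lX : A).
Local Notation z := (lX : A).
Local Notation B := (braid_presentation 3).
Local Notation G := (gen_mx (TYM 3) (braid_ab 3)).
Local Notation Phi := (Phi (TYM 3) (braid_ab 3)).

Definition gen_entry (i a b : nat) : A :=
  z * (if a == i then (b == i.+1)%:R
       else if a == i.+1 then t *+ (b == i) else (a == b)%:R).

Lemma gen_mx3E (i : 'I_2) : G i = \matrix_(a < 3, b < 3) gen_entry i a b.
Proof.
rewrite (gen_mxE (m := 0)); apply/matrixP=> a b; rewrite !mxE /gen_entry; congr (_ * _).
by case: ifP => _; [|case: ifP => _]; rewrite ?rmorphMn ?rmorph_nat ?rmorph1.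
Qed.

Lemma wada_denom3 (j : 'I_2) :
  wada_denom (TYM 3) (braid_ab 3) (j : 'I_(ngen B)) = (1 - z) * (1 - t * z ^+ 2).
Proof.
rewrite wada_denomE gen_mx3E.
have -> : 1%:M - \matrix_(a < 3, b < 3) gen_entry j a b =
    \matrix_(a < 3, b < 3) ((a == b :> nat)%:R - gen_entry j a b).
  by apply/matrixP=> a b; rewrite !mxE.
rewrite (det_mx33 (fun a b => (a == b)%:R - gen_entry j a b)).
by case: j => [[|[]]] //= _; rewrite /gen_entry /=; ring.
Qed.

Lemma det_braid_relator (k : 'I_2) :
  \det (Phi (fox_word (k : 'I_(ngen B)) (@braid_relator 3 0 1))) =
  (-1) ^+ k * ((1 + t * z ^+ 3) * ((1 - z) * (1 - t * z ^+ 2))).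
Proof.
have -> := Phi_fox_braid (TYM 3) (braid_ab 3) (k : 'I_(ngen B)) (@braid_relator_in 0 0 1 erefl).
rewrite !gen_mx3E.
(* The entries of 1 - G_1 + G_0 G_1 and of -(1 - G_0 + G_1 G_0), the derivatives with respect to the
   two generators. *)
pose rows0 := [:: [:: 1 - z; 0; z ^+ 2]; [:: t * z ^+ 2; 1; - z]; [:: 0; t * (z ^+ 2 - z); 1]].
pose rows1 := [:: [:: -1; z - z ^+ 2; 0]; [:: t * z; -1; - z ^+ 2];
                 [:: - (t * z) ^+ 2; 0; z - 1]].
have [k0|k1] : k = 0 \/ k = 1.
- by case: k => [[|[|//]]] k2; [left | right]; apply: val_inj.
- rewrite k0 eqxx scale1r scale0r addr0.
  set X := (X in \det X); have -> : X = \matrix_(a < 3, b < 3) (nth [::] rows0 a)`_b.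
    apply/matrixP=> a b; rewrite !mxE !big_ord_recr big_ord0 /= !mxE.
    by case: a => [[|[|[|//]]] ?]; case: b => [[|[|[|//]]] ?]; rewrite /gen_entry /=; ring.
  by rewrite (det_mx33 (fun a b => (nth [::] rows0 a)`_b)) /=; ring.
rewrite k1 eqxx scale1r scale0r add0r.
set X := (X in \det X); have -> : X = \matrix_(a < 3, b < 3) (nth [::] rows1 a)`_b.
  apply/matrixP=> a b; rewrite !mxE !big_ord_recr big_ord0 /= !mxE.
  by case: a => [[|[|[|//]]] ?]; case: b => [[|[|[|//]]] ?]; rewrite /gen_entry /=; ring.
by rewrite (det_mx33 (fun a b => (nth [::] rows1 a)`_b)) /=; ring.
Qed.

(** The only minor is, up to sign, the product of 1 + t z^3 and the denominator. *)
Lemma is_gcd_three_strands (j : 'I_2) :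
  is_gcd (is_minor (TYM 3) (braid_ab 3) (j : 'I_(ngen B)))
    ((1 + t * z ^+ 3) * wada_denom (TYM 3) (braid_ab 3) (j : 'I_(ngen B))).
Proof.
rewrite wada_denom3; move: (@three_strand_minor j).
rewrite det_braid_relator; move: (_ * (_ * _)) (nat_of_ord _) => g k minorE.
have sK : (-1) ^+ k * (-1) ^+ k = 1 :> A by rewrite -expr2 sqrr_sign.
split=> [x /minorE ->|d dM]; first by exists ((-1) ^+ k).
have [q qE] := dM _ (proj2 (minorE _) erefl).
by exists ((-1) ^+ k * q); rewrite -mulrA -qE mulrA sK mul1r.
Qed.

End ThreeStrandDeterminant.

(** * The invariant *)

Lemma braid_ab_surjective n (c : Zcyc) : (2 <= n)%N -> exists g, braid_ab n g = c.
Proof.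
case: n => [|[|n]] // _.
have [g1 g1E] : exists g, braid_ab n.+2 g = (1 : int) :> Zcyc.
  by exists (fpgen _ ord0); apply: braid_ab_gen.
have [gV gVE] : exists g, braid_ab n.+2 g = (-1 : int) :> Zcyc.
  by exists (fpgen _ ord0)^-1%g;
    rewrite /fpgen -wclass_inv [LHS]fplift_wclass /weval big_cons big_nil.
have pow (h : braid_group n.+2) (e : int) (k : nat) : braid_ab n.+2 h = e :> Zcyc ->
    exists g, braid_ab n.+2 g = (e *+ k : int) :> Zcyc.
  move=> hE; elim: k => [|k [g gE]]; first by exists 1%g; apply: multiplicative1.
  by exists (h * g)%g; rewrite gmulfM hE gE mulrS.
case: c => k.
  have [g gE] := pow _ _ k g1E; exists g; rewrite gE; exact: natz.
have [g gE] := pow _ _ k.+1 gVE; exists g; rewrite gE NegzE mulNrn; congr (- _); exact: natz.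
Qed.

Lemma is_gcd_minors (n : nat) (n_ge3 : (3 <= n)%N) (j : 'I_(ngen (braid_presentation n))) :
  is_gcd (is_minor (TYM n) (braid_ab n) j)
    ((if n == 3%N then 1 + lC lX * lX ^+ 3 else 1) * wada_denom (TYM n) (braid_ab n) j).
Proof.
case: n n_ge3 j => [|[|[|[|m]]]] // _ j; first exact: is_gcd_three_strands.
by rewrite mul1r; apply: (@is_gcd_wada_denom m.+1).
Qed.

Theorem theorem1p2 (n : nat) (n_ge3 : (3 <= n)%N) :
  let t : laurent int := lX in
  let z : laurent (laurent int) := lX in
  let value : {fraction (laurent (laurent int))} :=
    if n == 3%N then (1 + lC t * z ^+ 3)%:F else 1 in
  is_twisted_alexander (TYM n) (braid_ab n) value /\
  (forall Delta : {fraction (laurent (laurent int))},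
     is_twisted_alexander (TYM n) (braid_ab n) Delta ->
     eq_up_to_units Delta value).
Proof.
move=> t z value.
pose v : laurent (laurent int) := if n == 3%N then 1 + lC t * z ^+ 3 else 1.
have valueE : value = v%:F by rewrite /value /v; case: ifP; rewrite ?tofrac1.
have gcd_v := is_gcd_minors n_ge3.
split=> [|Delta [_ [j [g [D0 gcd_g ->]]]]].
  have n_gt1 : (0 < n.-1)%N by case: n n_ge3 {value v valueE gcd_v} => [|[]].
  pose j : 'I_(ngen (braid_presentation n)) := Ordinal n_gt1.
  have D0 : wada_denom (TYM n) (braid_ab n) j != 0.
    case: n n_ge3 {value v valueE gcd_v} n_gt1 @j => [|[|[|m]]] // _ n_gt1 j.
    by rewrite wada_denomE (@gen_mxE m) det_one_sub_lX_neq0.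
  split=> [c|]; first by apply: braid_ab_surjective; apply: ltnW.
  exists j, (v * wada_denom (TYM n) (braid_ab n) j); split=> //.
  by rewrite valueE tofracM mulfK // tofrac_eq0.
(* For the same j the two gcds differ by a unit, which is eps z^c, and the denominators cancel. *)
have [e /laurent_unitP[eps [c [eps_unit eE]]] gE] := gcd_unique gcd_g (gcd_v j).
exists eps, c; split=> //.
by rewrite gE mulrA tofracM mulfK ?tofrac_eq0 // eE valueE tofracM.
Qed.
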